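(* In scheme (H) of the context choose $\bar\lambda_{k+1}=\lambda_k+\frac{\alpha_k}{\theta_k}(Av_k+Bw_{k+1}-b)$. Then (H) becomes the following algorithm, started with $(x_0,v_0)\in\mathcal X\times\mathcal X$: $$\begin{cases}u_k=(x_k+\alpha_kv_k)/(1+\alpha_k),\\ \widehat\lambda_k=\lambda_k-\theta_k^{-1}(Ax_k+By_k-b)+\frac{\alpha_k}{\theta_k}A(v_k-x_k),\\ y_{k+1}=\operatorname{argmin}_{y\in\mathcal Y}\left\{\mathcal L_{\sigma_k}(x_k,y,\widehat\lambda_k)+\frac{\eta_{g,k}}{2\alpha_k^2}\|y-\widetilde y_k\|^2\right\},\quad\sigma_k=1/\theta_{k+1},\\ w_{k+1}=y_{k+1}+(y_{k+1}-y_k)/\alpha_k,\\ \bar\lambda_{k+1}=\lambda_k+\frac{\alpha_k}{\theta_k}(Av_k+Bw_{k+1}-b),\\ v_{k+1}=\operatorname{prox}^{\mathcal X}_{s_kf_2}\left[\widetilde v_k-s_k(\nabla f_1(u_k)+A^\top\bar\lambda_{k+1})\right],\quad s_k=\alpha_k/\widetilde\eta_{f,k},\\ x_{k+1}=(x_k+\alpha_kv_{k+1})/(1+\alpha_k),\\ \lambda_{k+1}=\lambda_k+\frac{\alpha_k}{\theta_k}(Av_{k+1}+Bw_{k+1}-b).\end{cases}$$ Assume $g\in\mathcal S^0_{\mu_g}(\mathcal Y)$ with $\mu_g\ge0$; $f=f_1+f_2$ with $f_2\in\mathcal S^0_0(\mathcal X)$ and $f_1\in\mathcal S^{1,1}_{\mu_f,L_f}(\mathcal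 X)$, $0\le\mu_f\le L_f<\infty$; $\gamma_0=\mu_f$ if $\mu_f>0$ and $\beta_0=\mu_g$ if $\mu_g>0$; and that the step sizes satisfy, for all $k$, $$(L_f\theta_k+\|A\|^2)\alpha_k^2=\gamma_k\theta_k .$$ Then $\{(x_k,y_k)\}_{k\ge1}\subset\mathcal X\times\mathcal Y$ and $\mathcal E_k\le\theta_k\mathcal E_0$ for all $k$. Moreover, if $\gamma_0\le L_f+\|A\|^2$, then $$\|Ax_k+By_k-b\|\le\theta_k\mathcal R_0,\qquad|F(x_k,y_k)-F^*|\le\theta_k(\mathcal E_0+\|\lambda^*\|\mathcal R_0),$$ where $\mathcal R_0=\sqrt{2\mathcal E_0}+\|\lambda_0-\lambda^*\|+\|Ax_0+By_0-b\|$, and, for all $k\ge1$, $$\theta_k\le C\min\left\{\frac{\|A\|}{\sqrt{\gamma_0}\,k}+\frac{L_f}{\gamma_0k^2},\quad\frac{\|A\|^2}{\mu_fk^2}+\exp\left(-\frac k4\sqrt{\frac{\mu_f}{L_f}}\right)\right\}$$ with a constant $C>0$ independent of $k$, $A$, $B$, $\mu_f$, $\mu_g$, $\gamma_0$ and $\beta_0$.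
   Context: Setting. $\mathcal X\subset\mathbb R^m$, $\mathcal Y\subset\mathbb R^n$ are closed convex sets, $A\in\mathbb R^{r\times m}$, $B\in\mathbb R^{r\times n}$, $b\in\mathbb R^r$, and $f:\mathbb R^m\to\mathbb R\cup\{+\infty\}$, $g:\mathbb R^n\to\mathbb R\cup\{+\infty\}$ are proper closed convex. The problem is to minimize $F(x,y)=f(x)+g(y)$ over $x\in\mathcal X,y\in\mathcal Y$ subject to $Ax+By=b$. $\mathcal L(x,y,\lambda)=F(x,y)+\delta_{\mathcal X\times\mathcal Y}(x,y)+\langle\lambda,Ax+By-b\rangle$ ($\delta$: indicator function) and $\mathcal L_\sigma(x,y,\lambda)=\mathcal L(x,y,\lambda)+\frac\sigma2\|Ax+By-b\|^2$. $(x^*,y^*,\lambda^* )\in\mathcal X\times\mathcal Y\times\mathbb R^r$ is a saddle point of $\mathcal L$ (assumed to exist): $\mathcal L(x^*,y^*,\lambda)\le\mathcal L(x^*,y^*,\lambda^* )\le\mathcal L(x,y,\lambda^* )$ for all $(x,y,\lambda)$; $F^*=F(x^*,y^* )$. Norms are Euclidean, and $\|A\|,\|B\|$ are the induced operator norms. $h\in\mathcal S^0_\mu(\mathcal X)$ means $h$ is proper closed convex and $h(x_1)-h(x_2)-\langle p,x_1-x_2\rangle\ge\frac\mu2\|x_1-x_2\|^2$ for all $x_1,x_2\in\mathcal X$, $p\in\partial h(x_2)$. $h\in\mathcal S^{1,1}_{\mu,L}(\mathcal X)$ means $h\in\mathcal S^0_\mu(\mathcal X)$ and $h$ has $L$-Lipschitz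 gradient in the sense $h(x_1)-h(x_2)-\langle\nabla h(x_2),x_1-x_2\rangle\le\frac L2\|x_1-x_2\|^2$ for all $x_1,x_2\in\mathcal X$. The classes over $\mathcal Y$ are analogous. $\operatorname{prox}^{\mathcal X}_{sh}(z)=\operatorname{argmin}_{x\in\mathcal X}\{h(x)+\frac1{2s}\|x-z\|^2\}$. Parameters. $\theta_0=1$, $\gamma_0>0$, $\beta_0>0$, step sizes $\alpha_k>0$, and $$\frac{\theta_{k+1}-\theta_k}{\alpha_k}=-\theta_{k+1},\quad\frac{\gamma_{k+1}-\gamma_k}{\alpha_k}=\mu_f-\gamma_{k+1},\quad\frac{\beta_{k+1}-\beta_k}{\alpha_k}=\mu_g-\beta_{k+1}.$$ $\widetilde\eta_{f,k}=\gamma_k+\mu_f\alpha_k$, $\widetilde v_k=\frac1{\widetilde\eta_{f,k}}(\gamma_kv_k+\mu_f\alpha_ku_k)$, $\eta_{g,k}=(\alpha_k+1)\beta_k+\mu_g\alpha_k$, $\widetilde y_k=y_k+\frac{\alpha_k\beta_k}{\eta_{g,k}}(w_k-y_k)$. Scheme (H), from an initial guess $(x_0,v_0,y_0,w_0,\lambda_0)$ with $(x_0,v_0)\in\mathcal X\times\mathcal X$; it is implicit, with the value $\bar\lambda_{k+1}$ (to be chosen) treated as a fixed vector inside the argmins: $$\begin{cases}u_k=(x_k+\alpha_kv_k)/(1+\alpha_k),\\ v_{k+1}=\operatorname{argmin}_{v\in\mathcal X}\{f_2(v)+\langle\nabla f_1(u_k)+A^\top\bar\lambda_{k+1},v\rangle+\frac{\widetilde\eta_{f,k}}{2\alpha_k}\|v-\widetilde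 v_k\|^2\},\\ x_{k+1}=(x_k+\alpha_kv_{k+1})/(1+\alpha_k),\\ y_{k+1}=\operatorname{argmin}_{y\in\mathcal Y}\{g(y)+\langle By,\bar\lambda_{k+1}\rangle+\frac{\eta_{g,k}}{2\alpha_k^2}\|y-\widetilde y_k\|^2\},\\ w_{k+1}=y_{k+1}+(y_{k+1}-y_k)/\alpha_k,\\ \lambda_{k+1}=\lambda_k+\frac{\alpha_k}{\theta_k}(Av_{k+1}+Bw_{k+1}-b).\end{cases}$$ Discrete Lyapunov function: $\mathcal E_k=\mathcal L(x_k,y_k,\lambda^* )-\mathcal L(x^*,y^*,\lambda_k)+\frac{\gamma_k}2\|v_k-x^*\|^2+\frac{\beta_k}2\|w_k-y^*\|^2+\frac{\theta_k}2\|\lambda_k-\lambda^*\|^2$. Convention: a term with $\mu_f$ in the denominator is $+\infty$ when $\mu_f=0$; the exponential is $1$ when $\mu_f=0$.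
   Formalization: In the classes S^0_μ over X or Y, ∂h is read as the subdifferential of h+δ over that set (with ∂h over the whole space the decay of E_k can fail when μ_g>0); that the algorithm conversely gives (H) is stated only for f(x_0)<+∞, since otherwise the y-argmin is all of Y. *)

(* Defs.v *)
From mathcomp Require Import all_boot all_order all_algebra.
From mathcomp Require Import all_classical all_reals all_analysis.

Set Implicit Arguments.
Unset Strict Implicit.
Unset Printing Implicit Defensive.

Import Order.TTheory GRing.Theory Num.Theory.
Import numFieldNormedType.Exports.

Local Open Scope classical_set_scope.
Local Open Scope ring_scope.

(* The norm that the library puts on 'cV[R]_m is the max norm; it induces the
   topology used below for closedness, semicontinuity and differentiability,
   but all norms in the formulas are the Euclidean ones defined here. *)
Definition dot (R : realType) (m : nat) (u v : 'cV[R]_m) : R :=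
  \sum_(i < m) u i 0 * v i 0.

Definition enorm (R : realType) (m : nat) (u : 'cV[R]_m) : R :=
  Num.sqrt (dot u u).

Definition opnorm (R : realType) (m r : nat) (A : 'M[R]_(r, m)) : R :=
  sup [set enorm (A *m x) | x in [set x : 'cV[R]_m | enorm x <= 1]].

Definition indicator (R : realType) (T : Type) (S : set T) (z : T) : \bar R :=
  if z \in S then 0%E else +oo%E.

Definition argmin (R : realType) (T : Type) (S : set T) (phi : T -> \bar R) :
    set T :=
  [set z | S z /\ forall z', S z' -> (phi z <= phi z')%E].

Definition proper (R : realType) (m : nat) (h : 'cV[R]_m -> \bar R) : Prop :=
  (forall x, (-oo < h x)%E) /\ (exists x, (h x < +oo)%E).

Definition econvex (R : realType) (m : nat) (h : 'cV[R]_m -> \bar R) : Prop :=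
  forall (x y : 'cV[R]_m) (t : R), 0 <= t <= 1 ->
    (h (t *: x + (1 - t) *: y)%R <= t%:E * h x + (1 - t)%:E * h y)%E.

Definition proper_closed_convex (R : realType) (m : nat)
    (h : 'cV[R]_m -> \bar R) : Prop :=
  [/\ proper h, lower_semicontinuous h & econvex h].

(* Subdifferential of h as a function on X, that is, of h + delta_X: it
   contains the subdifferential of h over the whole space, and equals
   dh(x) + N_X(x) under a constraint qualification.  The distinction matters:
   with the subgradients of h over the whole space only, strong convexity over
   X would hold vacuously, whatever mu is, when X meets dom h only at boundary
   points where h has no subgradient. *)
Definition subdiff (R : realType) (m : nat) (X : set 'cV[R]_m)
    (h : 'cV[R]_m -> \bar R) (x : 'cV[R]_m) : set 'cV[R]_m :=
  [set p | h x \is a fin_num /\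
     forall z, X z -> (h x + (dot p (z - x))%:E <= h z)%E].

Definition S0 (R : realType) (m : nat) (mu : R) (X : set 'cV[R]_m)
    (h : 'cV[R]_m -> \bar R) : Prop :=
  proper_closed_convex h /\
  forall x1 x2 p, X x1 -> X x2 -> subdiff X h x2 p ->
    ((mu / 2 * enorm (x1 - x2) ^+ 2)%:E
       <= h x1 - h x2 - (dot p (x1 - x2))%:E)%E.

Definition ediff (R : realType) (m : nat) (h : 'cV[R]_m -> \bar R)
    (x : 'cV[R]_m) : Prop :=
  (\forall z \near x, h z \is a fin_num) /\
  differentiable (fun z => fine (h z) : R^o) x.

Definition grad (R : realType) (m : nat) (h : 'cV[R]_m -> \bar R)
    (x : 'cV[R]_m) : 'cV[R]_m :=
  \col_(i < m) ('D_(delta_mx i 0) (fun z => fine (h z) : R^o) x).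

Definition S11 (R : realType) (m : nat) (mu L : R) (X : set 'cV[R]_m)
    (h : 'cV[R]_m -> \bar R) : Prop :=
  [/\ S0 mu X h, (forall x, X x -> ediff h x) &
    forall x1 x2, X x1 -> X x2 ->
      (h x1 - h x2 - (dot (grad h x2) (x1 - x2))%:E
         <= (L / 2 * enorm (x1 - x2) ^+ 2)%:E)%E].

Definition prox (R : realType) (m : nat) (X : set 'cV[R]_m) (s : R)
    (h : 'cV[R]_m -> \bar R) (z : 'cV[R]_m) : set 'cV[R]_m :=
  argmin X (fun x => h x + ((2 * s)^-1 * enorm (x - z) ^+ 2)%:E)%E.

Definition objective (R : realType) (m n : nat)
    (f : 'cV[R]_m -> \bar R) (g : 'cV[R]_n -> \bar R)
    (x : 'cV[R]_m) (y : 'cV[R]_n) : \bar R := (f x + g y)%E.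

Definition residual (R : realType) (m n r : nat)
    (A : 'M[R]_(r, m)) (B : 'M[R]_(r, n)) (b : 'cV[R]_r)
    (x : 'cV[R]_m) (y : 'cV[R]_n) : 'cV[R]_r := A *m x + B *m y - b.

Definition lagrangian (R : realType) (m n r : nat)
    (X : set 'cV[R]_m) (Y : set 'cV[R]_n)
    (A : 'M[R]_(r, m)) (B : 'M[R]_(r, n)) (b : 'cV[R]_r)
    (f : 'cV[R]_m -> \bar R) (g : 'cV[R]_n -> \bar R)
    (x : 'cV[R]_m) (y : 'cV[R]_n) (lam : 'cV[R]_r) : \bar R :=
  (objective f g x y + indicator R (X `*` Y) (x, y)
     + (dot lam (residual A B b x y))%:E)%E.

Definition aug_lagrangian (R : realType) (m n r : nat)
    (X : set 'cV[R]_m) (Y : set 'cV[R]_n)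
    (A : 'M[R]_(r, m)) (B : 'M[R]_(r, n)) (b : 'cV[R]_r)
    (f : 'cV[R]_m -> \bar R) (g : 'cV[R]_n -> \bar R) (sigma : R)
    (x : 'cV[R]_m) (y : 'cV[R]_n) (lam : 'cV[R]_r) : \bar R :=
  (lagrangian X Y A B b f g x y lam
     + (sigma / 2 * enorm (residual A B b x y) ^+ 2)%:E)%E.

(* The finiteness of the optimal value F(xs, ys) rules out the
   degenerate "saddle points" at which the Lagrangian is identically +oo. *)
Definition saddle_point (R : realType) (m n r : nat)
    (X : set 'cV[R]_m) (Y : set 'cV[R]_n)
    (A : 'M[R]_(r, m)) (B : 'M[R]_(r, n)) (b : 'cV[R]_r)
    (f : 'cV[R]_m -> \bar R) (g : 'cV[R]_n -> \bar R)
    (xs : 'cV[R]_m) (ys : 'cV[R]_n) (lams : 'cV[R]_r) : Prop :=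
  [/\ X xs, Y ys, objective f g xs ys \is a fin_num &
    forall x y lam,
      (lagrangian X Y A B b f g xs ys lam
         <= lagrangian X Y A B b f g xs ys lams)%E /\
      (lagrangian X Y A B b f g xs ys lams
         <= lagrangian X Y A B b f g x y lams)%E].

Definition parameters (R : realType) (mu_f mu_g : R)
    (alpha theta gamma beta : nat -> R) : Prop :=
  [/\ theta 0%N = 1, 0 < gamma 0%N, 0 < beta 0%N & forall k : nat,
    [/\ 0 < alpha k,
        (theta k.+1 - theta k) / alpha k = - theta k.+1,
        (gamma k.+1 - gamma k) / alpha k = mu_f - gamma k.+1 &
        (beta k.+1 - beta k) / alpha k = mu_g - beta k.+1]].

Definition eta_f (R : realType) (mu_f : R) (alpha gamma : nat -> R)
    (k : nat) : R := gamma k + mu_f * alpha k.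

Definition eta_g (R : realType) (mu_g : R) (alpha beta : nat -> R)
    (k : nat) : R := (alpha k + 1) * beta k + mu_g * alpha k.

Definition average (R : realType) (m : nat) (a : R) (x v : 'cV[R]_m) :
  'cV[R]_m := (1 + a)^-1 *: (x + a *: v).

Definition u_pt (R : realType) (m : nat) (alpha : nat -> R)
    (x v : nat -> 'cV[R]_m) (k : nat) : 'cV[R]_m :=
  average (alpha k) (x k) (v k).

Definition v_tilde (R : realType) (m : nat) (mu_f : R)
    (alpha gamma : nat -> R) (x v : nat -> 'cV[R]_m) (k : nat) : 'cV[R]_m :=
  (eta_f mu_f alpha gamma k)^-1 *:
    (gamma k *: v k + (mu_f * alpha k) *: u_pt alpha x v k).

Definition y_tilde (R : realType) (n : nat) (mu_g : R)
    (alpha beta : nat -> R) (y w : nat -> 'cV[R]_n) (k : nat) : 'cV[R]_n :=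
  y k + (alpha k * beta k / eta_g mu_g alpha beta k) *: (w k - y k).

(* In both schemes below [lamb k.+1] is the multiplier written
   \bar\lambda_{k+1}; the value [lamb 0] is not used. *)
Definition scheme_H (R : realType) (m n r : nat)
    (X : set 'cV[R]_m) (Y : set 'cV[R]_n)
    (A : 'M[R]_(r, m)) (B : 'M[R]_(r, n)) (b : 'cV[R]_r)
    (f1 f2 : 'cV[R]_m -> \bar R) (g : 'cV[R]_n -> \bar R)
    (mu_f mu_g : R) (alpha theta gamma beta : nat -> R)
    (x v : nat -> 'cV[R]_m) (y w : nat -> 'cV[R]_n)
    (lam lamb : nat -> 'cV[R]_r) : Prop :=
  forall k : nat,
  [/\ argmin X (fun z =>
        f2 z
        + (dot (grad f1 (u_pt alpha x v k) + A^T *m lamb k.+1) z)%:E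
        + (eta_f mu_f alpha gamma k / (2 * alpha k)
             * enorm (z - v_tilde mu_f alpha gamma x v k) ^+ 2)%:E)%E (v k.+1),
      x k.+1 = average (alpha k) (x k) (v k.+1),
      argmin Y (fun z =>
        g z + (dot (B *m z) (lamb k.+1))%:E
        + (eta_g mu_g alpha beta k / (2 * alpha k ^+ 2)
             * enorm (z - y_tilde mu_g alpha beta y w k) ^+ 2)%:E)%E (y k.+1),
      w k.+1 = y k.+1 + (alpha k)^-1 *: (y k.+1 - y k) &
      lam k.+1 = lam k + (alpha k / theta k) *:
                           residual A B b (v k.+1) (w k.+1)].

Definition multiplier_choice (R : realType) (m n r : nat)
    (A : 'M[R]_(r, m)) (B : 'M[R]_(r, n)) (b : 'cV[R]_r)
    (alpha theta : nat -> R)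
    (v : nat -> 'cV[R]_m) (w : nat -> 'cV[R]_n)
    (lam lamb : nat -> 'cV[R]_r) : Prop :=
  forall k : nat,
    lamb k.+1 = lam k + (alpha k / theta k) *: residual A B b (v k) (w k.+1).

Definition lam_hat (R : realType) (m n r : nat)
    (A : 'M[R]_(r, m)) (B : 'M[R]_(r, n)) (b : 'cV[R]_r)
    (alpha theta : nat -> R)
    (x v : nat -> 'cV[R]_m) (y : nat -> 'cV[R]_n) (lam : nat -> 'cV[R]_r)
    (k : nat) : 'cV[R]_r :=
  lam k - (theta k)^-1 *: residual A B b (x k) (y k)
    + (alpha k / theta k) *: (A *m (v k - x k)).

Definition algorithm (R : realType) (m n r : nat)
    (X : set 'cV[R]_m) (Y : set 'cV[R]_n)
    (A : 'M[R]_(r, m)) (B : 'M[R]_(r, n)) (b : 'cV[R]_r)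
    (f f1 f2 : 'cV[R]_m -> \bar R) (g : 'cV[R]_n -> \bar R)
    (mu_f mu_g : R) (alpha theta gamma beta : nat -> R)
    (x v : nat -> 'cV[R]_m) (y w : nat -> 'cV[R]_n)
    (lam lamb : nat -> 'cV[R]_r) : Prop :=
  forall k : nat,
  let s := alpha k / eta_f mu_f alpha gamma k in
  [/\ argmin Y (fun z =>
        aug_lagrangian X Y A B b f g (theta k.+1)^-1 (x k) z
          (lam_hat A B b alpha theta x v y lam k)
        + (eta_g mu_g alpha beta k / (2 * alpha k ^+ 2)
             * enorm (z - y_tilde mu_g alpha beta y w k) ^+ 2)%:E)%E (y k.+1),
      w k.+1 = y k.+1 + (alpha k)^-1 *: (y k.+1 - y k),
      lamb k.+1 = lam k + (alpha k / theta k) *: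
                            residual A B b (v k) (w k.+1) &
  [/\ prox X s f2
        (v_tilde mu_f alpha gamma x v k
           - s *: (grad f1 (u_pt alpha x v k) + A^T *m lamb k.+1)) (v k.+1),
      x k.+1 = average (alpha k) (x k) (v k.+1) &
      lam k.+1 = lam k + (alpha k / theta k) *:
                           residual A B b (v k.+1) (w k.+1)]].

(* The value is +oo when (x_k, y_k) is outside the domain of F or outside
   X x Y, which is possible for k = 0 as no constraint is put on y_0. *)
Definition lyapunov (R : realType) (m n r : nat)
    (X : set 'cV[R]_m) (Y : set 'cV[R]_n)
    (A : 'M[R]_(r, m)) (B : 'M[R]_(r, n)) (b : 'cV[R]_r)
    (f : 'cV[R]_m -> \bar R) (g : 'cV[R]_n -> \bar R)
    (theta gamma beta : nat -> R)
    (xs : 'cV[R]_m) (ys : 'cV[R]_n) (lams : 'cV[R]_r)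
    (x v : nat -> 'cV[R]_m) (y w : nat -> 'cV[R]_n) (lam : nat -> 'cV[R]_r)
    (k : nat) : \bar R :=
  (lagrangian X Y A B b f g (x k) (y k) lams
   - lagrangian X Y A B b f g xs ys (lam k)
   + (gamma k / 2 * enorm (v k - xs) ^+ 2)%:E
   + (beta k / 2 * enorm (w k - ys) ^+ 2)%:E
   + (theta k / 2 * enorm (lam k - lams) ^+ 2)%:E)%E.

(* When mu_f = 0 the exponential below is exp(0) = 1, also if L_f = 0 since
   0 / 0 = 0 here. *)
Definition theta_rate (R : realType) (normA mu_f L_f gamma0 : R) (k : nat) :
    \bar R :=
  mine
    (normA / (Num.sqrt gamma0 * k%:R) + L_f / (gamma0 * k%:R ^+ 2))%:E
    ((if mu_f == 0%R then +oo else (normA ^+ 2 / (mu_f * k%:R ^+ 2))%:E)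
       + (expR (- (k%:R / 4 * Num.sqrt (mu_f / L_f))))%:E)%E.

(* Main.v *)
(* Both minimizations of a step have the form h + q with q a convex quadratic,
   and y minimizes h + q over a convex set iff minus the gradient of q at y is a
   subgradient of h at y.  Hence the y-steps of (H) and of the algorithm agree as
   soon as the gradients agree, which is how lam_hat is determined.

   Let a = ||A||.  Adding the smoothness inequality of f1 at u_k, the strong
   convexity of f1 and g and the two optimality conditions, tested against the
   previous iterate and the saddle point, gives (1 + alpha_k) E_{k+1} - E_k <= 0 up to the terms
     alpha_k <A (v_{k+1} - v_k), lam_{k+1} - lam_k>
       - theta_k / 2 |lam_{k+1} - lam_k|^2
       - (gamma_k - L alpha_k^2) / 2 |v_{k+1} - v_k|^2,
   and (L theta_k + a^2) alpha_k^2 = gamma_k theta_k makes these nonpositive.  The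
   feasibility bound follows because lam_k - (A x_k + B y_k - b) / theta_k is
   constant along the iterates.

   For the rate, gamma_k >= gamma_0 theta_k makes a / theta_k + 2 sqrt(L / theta_k)
   grow by at least 2/3 sqrt gamma_0 per step; if mu_f > 0, gamma_k = mu_f makes
   3/2 a / sqrt theta_k - sqrt L ln theta_k grow by at least 1/2 sqrt mu_f.
   In either case one of the two summands carries half of the growth. *)
Require Import Defs.
From mathcomp Require Import all_boot all_order all_algebra.
From mathcomp Require Import all_classical all_reals all_analysis.
From mathcomp Require Import ring lra.
Import Order.TTheory GRing.Theory Num.Theory.
Import numFieldNormedType.Exports.
Local Open Scope classical_set_scope.
Local Open Scope ring_scope.

Set Implicit Arguments.
Unset Strict Implicit.
Unset Printing Implicit Defensive.

(** * The decay of theta *)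

Lemma linear_growth (R : realType) (W : nat -> R) (c : R) :
  0 <= W 0%N -> (forall k, W k + c <= W k.+1) -> forall k, k%:R * c <= W k.
Proof.
move=> W0 dW; elim=> [|k IH]; first by rewrite mul0r.
by apply: le_trans (dW k); rewrite -natr1 mulrDl mul1r lerD2r.
Qed.

Lemma le_of_sqr (R : realDomainType) (x y : R) :
  0 <= y -> x ^+ 2 <= y ^+ 2 -> x <= y.
Proof.
move=> y0; rewrite leNgt => h; rewrite leNgt; apply: contra h => yx; nra.
Qed.

Section rate.
Variables (R : realType) (a L g0 : R) (theta alpha : nat -> R).
Hypotheses (a_ge0 : 0 <= a) (L_ge0 : 0 <= L) (g0_gt0 : 0 < g0).
Hypotheses (theta0 : theta 0%N = 1) (theta_gt0 : forall k, 0 < theta k).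
Hypotheses (alpha01 : forall k, 0 < alpha k <= 1).
Hypothesis thetaS : forall k, theta k = (1 + alpha k) * theta k.+1.

Let s k := (Num.sqrt (theta k))^-1.

Let s_gt0 k : 0 < s k. Proof. by rewrite invr_gt0 sqrtr_gt0. Qed.

Let s_ge0 k : 0 <= s k. Proof. exact: ltW. Qed.

Let theta_ge0 k : 0 <= theta k. Proof. exact: ltW. Qed.

Let alpha_ge0 k : 0 <= alpha k. Proof. by have /andP[/ltW] := alpha01 k. Qed.

Let g0_ge0 : 0 <= g0. Proof. exact: ltW. Qed.

Let s_sqr k : s k ^+ 2 = (theta k)^-1.
Proof. by rewrite exprVn sqr_sqrtr ?ltW. Qed.

Let s_sqrtK k : s k * Num.sqrt (theta k) = 1.
Proof. by rewrite mulVf// gt_eqF// sqrtr_gt0. Qed.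

(** [s k ^+ 2] is multiplied by [1 + alpha k] at each step, and (1 + t/3)^2 <= 1 + t for 0 <= t <=
    1. *)
Let sS k : s k * (1 + alpha k / 3) <= s k.+1.
Proof.
have [[/andP[al0 al1] sk] sk1] := (alpha01 k, s_gt0 k, s_gt0 k.+1).
have p : 0 < 1 + alpha k / 3 by lra.
apply: le_of_sqr; first exact: ltW.
rewrite exprMn !s_sqr thetaS invfM mulrAC -[leRHS]mul1r ler_wpM2r//.
  by rewrite invr_ge0 ltW.
by rewrite mulrC ler_pdivrMr; nra.
Qed.

(** The hypothesis is what the step-size rule yields once gamma_k >= g0 theta_k. Its square root
    reads sqrt g0 <= alpha (a s^2 + sqrt L s). In [W], the term a s^2 grows by exactly alpha a s^2
    and, by [sS], 2 sqrt L s grows by at least 2/3 alpha sqrt L s; hence the factor 2/3. *)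
Lemma theta_sublinear :
  (forall k, g0 * theta k ^+ 2 <= (L * theta k + a ^+ 2) * alpha k ^+ 2) ->
  forall k, (1 <= k)%N ->
  theta k <= 36 * (a / (Num.sqrt g0 * k%:R) + L / (g0 * k%:R ^+ 2)).
Proof.
move=> step k k1.
have sL0 : 0 <= Num.sqrt L by rewrite sqrtr_ge0.
have sg0 : 0 < Num.sqrt g0 by rewrite sqrtr_gt0.
have k0 : 0 < k%:R :> R by rewrite ltr0n.
have t0 := theta_gt0 k.
have s0 := s_gt0 k.
pose W k := a * s k ^+ 2 + 2 * Num.sqrt L * s k.
have W0 : 0 <= W 0%N.
  by rewrite addr_ge0 ?mulr_ge0 ?exprn_ge0.
have dW j : W j + 2 / 3 * Num.sqrt g0 <= W j.+1.
  have /andP[al0 _] := alpha01 j.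
  have q0 : 0 < Num.sqrt (theta j) by rewrite sqrtr_gt0.
  (* Subadditivity of the square root: L theta + a^2 <= (a + sqrt L sqrt theta)^2. *)
  have sq : Num.sqrt g0 * theta j <= alpha j * (a + Num.sqrt L * Num.sqrt (theta j)).
    apply: le_of_sqr; first by rewrite mulr_ge0 ?addr_ge0 ?mulr_ge0// sqrtr_ge0.
    rewrite !exprMn (sqr_sqrtr g0_ge0); apply: le_trans (step j) _.
    rewrite mulrC ler_wpM2l// ?exprn_ge0 // sqrrD exprMn !sqr_sqrtr //.
    have := mulr_ge0 a_ge0 (mulr_ge0 sL0 (ltW q0)); lra.
  have sg : Num.sqrt g0 <= alpha j * (a * s j ^+ 2 + Num.sqrt L * s j).
    rewrite -(ler_pM2r (theta_gt0 j)); apply: le_trans sq _.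
    have e1 : s j ^+ 2 * theta j = 1 by rewrite s_sqr mulVf// gt_eqF.
    have e2 : s j * theta j = Num.sqrt (theta j).
      by rewrite -{1}[theta j]sqr_sqrtr// expr2 mulrA s_sqrtK mul1r.
    rewrite (_ : _ * theta j = alpha j * (a * (s j ^+ 2 * theta j)
        + Num.sqrt L * (s j * theta j))); last by ring.
    by rewrite e1 e2 mulr1.
  have /(ler_wpM2l sL0) h := sS j.
  have s2 : s j.+1 ^+ 2 = s j ^+ 2 * (1 + alpha j).
    rewrite !s_sqr (thetaS j) invfM mulrAC mulVf ?mul1r// gt_eqF//; lra.
  rewrite /W s2.
  have := mulr_ge0 a_ge0 (mulr_ge0 (ltW al0) (exprn_ge0 2 (ltW (s_gt0 j)))).
  nra.
have := @linear_growth _ W _ W0 dW k; rewrite /W => hW.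
have th1 : theta k * s k ^+ 2 = 1 by rewrite s_sqr divff// gt_eqF.
have p1 : 0 <= a / (Num.sqrt g0 * k%:R) by rewrite divr_ge0// mulr_ge0 ?sqrtr_ge0.
have p2 : 0 <= L / (g0 * k%:R ^+ 2) by rewrite divr_ge0// mulr_ge0 ?exprn_ge0.
(* Since [W k] is at least 2/3 sqrt g0 k, one of its summands is at least 1/3 sqrt g0 k. The first
   gives theta <= 3 a / (sqrt g0 k); the second gives sqrt g0 k <= 6 sqrt L s, whose square produces
   the constant 36. *)
have [h|h] := leP (Num.sqrt g0 * k%:R) (3 * (a * s k ^+ 2)).
  apply: (@le_trans _ _ (3 * (a / (Num.sqrt g0 * k%:R)))); last lra.
  rewrite mulrA ler_pdivlMr ?mulr_gt0//.
  have := ler_wpM2l (ltW t0) h.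
  rewrite (_ : theta k * (3 * _) = 3 * a * (theta k * s k ^+ 2)); last by ring.
  by rewrite th1 mulr1.
have {}h : Num.sqrt g0 * k%:R <= 6 * (Num.sqrt L * s k) by lra.
apply: (@le_trans _ _ (36 * (L / (g0 * k%:R ^+ 2)))); last lra.
rewrite mulrA ler_pdivlMr ?mulr_gt0 ?exprn_gt0//.
have : (Num.sqrt g0 * k%:R) ^+ 2 <= (6 * (Num.sqrt L * s k)) ^+ 2.
  by rewrite ler_pXn2r// nnegrE !mulr_ge0 ?sqrtr_ge0.
rewrite !exprMn !sqr_sqrtr// => /(ler_wpM2l (ltW t0)).
rewrite (_ : theta k * (6 ^+ 2 * _) = 36 * L * (theta k * s k ^+ 2)); last by ring.
by rewrite th1 mulr1.
Qed.

(** Here the hypothesis is the step-size rule with gamma_k = g0, so that sqrt g0 <= alpha (a s +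
    sqrt L). The weight 3/2 in [W] turns the growth factor 1/3 of [sS] into 1/2, matching ln (1 +
    alpha) >= alpha / 2. *)
Lemma theta_exponential : 0 < L ->
  (forall k, g0 * theta k <= (L * theta k + a ^+ 2) * alpha k ^+ 2) ->
  forall k, (1 <= k)%N ->
  theta k <= 36 * (a ^+ 2 / (g0 * k%:R ^+ 2)
                   + expR (- (k%:R / 4 * Num.sqrt (g0 / L)))).
Proof.
move=> L_gt0 step k k1.
have sL0 : 0 <= Num.sqrt L by rewrite sqrtr_ge0.
have sL1 : 0 < Num.sqrt L by rewrite sqrtr_gt0.
have sg0 : 0 < Num.sqrt g0 by rewrite sqrtr_gt0.
have k0 : 0 < k%:R :> R by rewrite ltr0n.
have t0 := theta_gt0 k.
have s0 := s_gt0 k.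
pose W k := 3 / 2 * (a * s k) - Num.sqrt L * ln (theta k).
have W0 : 0 <= W 0%N.
  by rewrite /W theta0 ln1 mulr0 subr0 !mulr_ge0.
have dW j : W j + 1 / 2 * Num.sqrt g0 <= W j.+1.
  have /andP[al0 al1] := alpha01 j.
  have q0 : 0 < Num.sqrt (theta j) by rewrite sqrtr_gt0.
  have sq : Num.sqrt g0 * Num.sqrt (theta j) <=
      alpha j * (a + Num.sqrt L * Num.sqrt (theta j)).
    apply: le_of_sqr; first by rewrite mulr_ge0 ?addr_ge0 ?mulr_ge0// sqrtr_ge0.
    rewrite !exprMn !sqr_sqrtr//; apply: le_trans (step j) _.
    rewrite mulrC ler_wpM2l// ?exprn_ge0 // sqrrD exprMn !sqr_sqrtr //.
    have := mulr_ge0 a_ge0 (mulr_ge0 sL0 (ltW q0)); lra.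
  have sg : Num.sqrt g0 <= alpha j * (a * s j + Num.sqrt L).
    rewrite -(ler_pM2r q0); apply: le_trans sq _.
    by rewrite -mulrA ler_wpM2l // mulrDl -!mulrA s_sqrtK mulr1.
  have /(ler_wpM2l a_ge0) h := sS j.
  have lnD : ln (theta j) = ln (1 + alpha j) + ln (theta j.+1).
    by rewrite thetaS lnM// posrE// addr_gt0.
  (* ln (1 + t) >= 1 - 1 / (1 + t) = t / (1 + t), and t <= 1 makes this at least t / 2. *)
  have lnal : alpha j / 2 <= ln (1 + alpha j).
    have p : 0 < 1 + alpha j by lra.
    have v : -1 < (1 + alpha j)^-1 - 1 by rewrite ltrBrDl subrr invr_gt0.
    have := le_ln1Dx v; rewrite addrC subrK lnV ?posrE// => hv.
    have : alpha j / 2 <= 1 - (1 + alpha j)^-1.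
      rewrite -(ler_pM2r p) mulrBl mulVf ?gt_eqF//; nra.
    lra.
  rewrite /W lnD; have := ler_wpM2l sL0 lnal; nra.
have := @linear_growth _ W _ W0 dW k; rewrite /W => hW.
have th1 : theta k * s k ^+ 2 = 1 by rewrite s_sqr divff// gt_eqF.
have p1 : 0 <= a ^+ 2 / (g0 * k%:R ^+ 2).
  by rewrite divr_ge0// ?mulr_ge0 ?exprn_ge0.
have p2 := expR_gt0 (- (k%:R / 4 * Num.sqrt (g0 / L))).
(* One summand of [W k] is at least 1/4 sqrt g0 k. If it is the logarithm, this is the exponential
   bound with its rate 1/4. *)
have [h|h] := leP (Num.sqrt g0 * k%:R) (6 * (a * s k)).
  apply: (@le_trans _ _ (36 * (a ^+ 2 / (g0 * k%:R ^+ 2)))); last lra.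
  rewrite mulrA ler_pdivlMr ?mulr_gt0 ?exprn_gt0//.
  have : (Num.sqrt g0 * k%:R) ^+ 2 <= (6 * (a * s k)) ^+ 2.
    by rewrite ler_pXn2r// nnegrE !mulr_ge0 ?sqrtr_ge0.
  rewrite !exprMn !sqr_sqrtr// => /(ler_wpM2l (ltW t0)).
  rewrite (_ : theta k * (6 ^+ 2 * _) = 36 * a ^+ 2 * (theta k * s k ^+ 2)); last by ring.
  by rewrite th1 mulr1.
suff : theta k <= expR (- (k%:R / 4 * Num.sqrt (g0 / L))) by lra.
rewrite -[theta k]lnK ?posrE// ler_expR lerNr.
rewrite sqrtrM // sqrtrV // mulrA ler_pdivrMr//.
lra.
Qed.

End rate.

(** * Euclidean norms and first-order optimality *)

Section dot.
Variables (R : realType) (m : nat).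
Implicit Types (u v w : 'cV[R]_m) (c : R).

Lemma dotC u v : dot u v = dot v u.
Proof. by apply: eq_bigr => i _; rewrite mulrC. Qed.

Lemma dotDl u v w : dot (u + v) w = dot u w + dot v w.
Proof. by rewrite -big_split; apply: eq_bigr => i _; rewrite mxE mulrDl. Qed.

Lemma dotZl c u v : dot (c *: u) v = c * dot u v.
Proof. by rewrite mulr_sumr; apply: eq_bigr => i _; rewrite mxE mulrA. Qed.

Lemma dotNl u v : dot (- u) v = - dot u v.
Proof. by rewrite -scaleN1r dotZl mulN1r. Qed.

Lemma dotDr u v w : dot w (u + v) = dot w u + dot w v.
Proof. by rewrite dotC dotDl !(dotC w). Qed.

Lemma dotZr c u v : dot v (c *: u) = c * dot v u.
Proof. by rewrite dotC dotZl dotC. Qed.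

Lemma dotNr u v : dot v (- u) = - dot v u.
Proof. by rewrite dotC dotNl dotC. Qed.

Definition dotE := (dotDl, dotDr, dotNl, dotNr, dotZl, dotZr).

Lemma dot_ge0 u : 0 <= dot u u.
Proof. by apply: sumr_ge0 => i _; rewrite -expr2 sqr_ge0. Qed.

Lemma dot_eq0 u : (dot u u == 0) = (u == 0).
Proof.
apply/idP/eqP => [|->]; last first.
  by rewrite /dot big1// => i _; rewrite mxE mul0r.
rewrite psumr_eq0 => [/allP u0|i _]; last by rewrite -expr2 sqr_ge0.
apply/matrixP => i j; rewrite ord1 mxE.
by have /implyP := u0 i (mem_index_enum i); rewrite -expr2 sqrf_eq0 => /(_ isT)/eqP.
Qed.

Lemma enorm_ge0 u : 0 <= enorm u. Proof. exact: sqrtr_ge0. Qed.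

Lemma sqr_enorm u : enorm u ^+ 2 = dot u u.
Proof. by rewrite sqr_sqrtr// dot_ge0. Qed.

Lemma cauchy_schwarz u v : `|dot u v| <= enorm u * enorm v.
Proof.
rewrite -(@ler_pXn2r R 2)// ?nnegrE ?mulr_ge0 ?enorm_ge0//.
rewrite real_normK ?num_real// exprMn !sqr_enorm.
have [/eqP|v0] := eqVneq (dot v v) 0.
  by rewrite dot_eq0 => /eqP ->; rewrite -(scale0r 0) !dotE !mul0r mulr0 expr0n.
(* This square expands to [dot v v] times the difference of the two sides. *)
have := dot_ge0 (dot v v *: u - dot u v *: v).
rewrite !dotE (dotC v u) => h.
have v1 : 0 < dot v v by rewrite lt_def v0 dot_ge0.
rewrite -subr_ge0 -(pmulr_rge0 _ v1).
by apply: le_trans h _; rewrite le_eqVlt; apply/orP; left; apply/eqP; ring.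
Qed.

Lemma enormD u v : enorm (u + v) <= enorm u + enorm v.
Proof.
rewrite -(@ler_pXn2r R 2)// ?nnegrE ?addr_ge0 ?enorm_ge0//.
rewrite sqrrD !sqr_enorm !dotE (dotC v u).
have := le_trans (ler_norm _) (cauchy_schwarz u v); lra.
Qed.

Lemma enormN u : enorm (- u) = enorm u.
Proof. by rewrite /enorm !dotE opprK. Qed.

Lemma enormZ c u : enorm (c *: u) = `|c| * enorm u.
Proof. by rewrite /enorm !dotE mulrA -expr2 sqrtrM ?sqr_ge0// sqrtr_sqr. Qed.

Lemma enorm_eq0 u : (enorm u == 0) = (u == 0).
Proof. by rewrite -sqrf_eq0 sqr_enorm dot_eq0. Qed.

Lemma enorm0 : enorm (0 : 'cV[R]_m) = 0.
Proof. by apply/eqP; rewrite enorm_eq0. Qed.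

End dot.

Lemma dot_trmx (R : realType) (m r : nat) (A : 'M[R]_(r, m)) (p : 'cV[R]_r)
    (u : 'cV[R]_m) : dot (A^T *m p) u = dot p (A *m u).
Proof.
rewrite /dot.
under eq_bigr do rewrite mxE mulr_suml.
under [RHS]eq_bigr do rewrite mxE mulr_sumr.
rewrite exchange_big; apply: eq_bigr => i _; apply: eq_bigr => j _.
by rewrite mxE; ring.
Qed.

(** The Frobenius norm is an upper bound, by Cauchy-Schwarz applied to each row; this makes the
    [sup] in [opnorm] a genuine supremum. *)
Lemma has_sup_opnorm (R : realType) (m r : nat) (A : 'M[R]_(r, m)) :
  has_sup [set enorm (A *m x) | x in [set x : 'cV[R]_m | enorm x <= 1]].
Proof.
split; first by exists (enorm (A *m 0)), 0 => //=; rewrite enorm0.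
exists (Num.sqrt (\sum_(i < r) dot (row i A)^T (row i A)^T)) => _ [x /= x1 <-].
rewrite ler_wsqrtr//; apply: ler_sum => i _.
have -> : (A *m x) i 0 = dot (row i A)^T x.
  by rewrite mxE; apply: eq_bigr => j _; rewrite !mxE.
rewrite -expr2 -real_normK ?num_real// -sqr_enorm.
rewrite ler_pXn2r// ?nnegrE ?enorm_ge0//.
by apply: le_trans (cauchy_schwarz _ _) _; rewrite ler_piMr ?enorm_ge0.
Qed.

Lemma opnorm_ge0 (R : realType) (m r : nat) (A : 'M[R]_(r, m)) : 0 <= opnorm A.
Proof.
apply: ub_le_sup; first by case: (has_sup_opnorm A).
by exists 0 => /=; rewrite ?mulmx0 enorm0.
Qed.

Lemma enorm_mulmx (R : realType) (m r : nat) (A : 'M[R]_(r, m)) (u : 'cV[R]_m) :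
  enorm (A *m u) <= opnorm A * enorm u.
Proof.
have [/eqP|u0] := eqVneq (enorm u) 0.
  by rewrite enorm_eq0 => /eqP ->; rewrite mulmx0 !enorm0 mulr0.
have u1 : 0 < enorm u by rewrite lt_def u0 enorm_ge0.
rewrite -ler_pdivrMr// mulrC.
have <- : enorm (A *m ((enorm u)^-1 *: u)) = (enorm u)^-1 * enorm (A *m u).
  by rewrite -scalemxAr enormZ ger0_norm// invr_ge0 enorm_ge0.
apply: sup_upper_bound; first exact: has_sup_opnorm.
exists ((enorm u)^-1 *: u) => //=.
by rewrite enormZ ger0_norm ?invr_ge0 ?enorm_ge0// mulVf.
Qed.

(** * Convexity, minimizers and subgradients *)

Lemma convex_comb (R : realType) (m : nat) (X : set 'cV[R]_m) (x y : 'cV[R]_m)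
    (t : R) : convex_set X -> 0 <= t <= 1 -> X x -> X y ->
  X (t *: x + (1 - t) *: y).
Proof.
move=> cX /andP[t0 t1] Xx Xy.
have := cX x y (Itv01 t0 t1); rewrite !inE => /(_ Xx Xy).
by [].
Qed.

(** Properness excludes [-oo] at the combination and the convexity bound excludes [+oo], so the
    inequality passes to real values. *)
Lemma econvex_fine (R : realType) (m : nat) (h : 'cV[R]_m -> \bar R)
    (x y : 'cV[R]_m) (t : R) : Defs.proper h -> econvex h -> 0 <= t <= 1 ->
  h x \is a fin_num -> h y \is a fin_num ->
  h (t *: x + (1 - t) *: y) \is a fin_num /\
  fine (h (t *: x + (1 - t) *: y)) <= t * fine (h x) + (1 - t) * fine (h y).
Proof.
move=> [hNy _] hc t01 hx hy.
have := hc x y t t01; rewrite -{1}(fineK hx) -{1}(fineK hy) -!EFinM -EFinD.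
by set z := _ + _; move: (hNy z); case: (h z).
Qed.

Lemma average_comb (R : realType) (m : nat) (a : R) (x v : 'cV[R]_m) : 0 < a ->
  let t := (1 + a)^-1 in
  0 <= t <= 1 /\ average a x v = t *: x + (1 - t) *: v.
Proof.
move=> a0 t.
have a1 : 0 < 1 + a by lra.
split.
  rewrite invr_ge0 ltW//= invf_le1//; lra.
rewrite /average -/t scalerDr scalerA; congr (_ + _ *: _).
by rewrite /t; field; lra.
Qed.

(** Replaces the limit t -> 0 in variational arguments. If s < 0, the choice t = -s / d with d = -s
    + |c| + 1 gives d (s + t c) = s (d - c) < 0. *)
Lemma ge0_small_perturb (R : realFieldType) (s c : R) :
  (forall t, 0 < t <= 1 -> 0 <= s + t * c) -> 0 <= s.
Proof.
move=> h; rewrite leNgt; apply/negP => s0.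
have d0 : 0 < - s + `|c| + 1 by have := normr_ge0 c; lra.
have := h (- s / (- s + `|c| + 1)).
rewrite divr_gt0 ?ler_pdivrMr//; last lra.
have -> : (- s <= 1 * (- s + `|c| + 1)) by have := normr_ge0 c; lra.
move=> /(_ isT); rewrite -(pmulr_rge0 _ d0) mulrDr.
rewrite (_ : _ * (- s / _ * c) = - s * c); last by field; lra.
have := ler_norm c; nra.
Qed.

(** An exact second-order expansion at [y] with gradient [p] and nonnegative curvature [Q]: a convex
    quadratic described without derivatives. *)
Definition quadratic_at (R : realType) (m : nat) (q : 'cV[R]_m -> R)
    (y p : 'cV[R]_m) : Prop :=
  exists2 Q : 'cV[R]_m -> R, (forall e, 0 <= Q e) &
    forall e t, q (y + t *: e) = q y + t * dot p e + t ^+ 2 * Q e.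

(* Only the gradient [p] of [q] at [y] enters the right-hand side, so two convex
   quadratics with the same gradient at [y] are interchangeable here. *)
Lemma argmin_subdiff (R : realType) (m : nat) (Y : set 'cV[R]_m)
    (h : 'cV[R]_m -> \bar R) (q : 'cV[R]_m -> R) (y p z0 : 'cV[R]_m) :
  convex_set Y -> Defs.proper h -> econvex h -> Y z0 -> (h z0 < +oo)%E ->
  quadratic_at q y p ->
  argmin Y (fun z => h z + (q z)%:E)%E y <-> Y y /\ subdiff Y h y (- p).
Proof.
move=> cY ph ch Yz0 hz0 [Q Q0 qE].
have hNy := ph.1.
split=> [[Yy ymin]|[Yy [hy ysub]]]; last first.
  split=> // z Yz; have := ysub z Yz.
  rewrite -(fineK hy); case: (h z) (hNy z) => [s _|_ _|//]; last by rewrite leey.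
  rewrite -!EFinD !lee_fin dotNl.
  have := qE (z - y) 1; rewrite scale1r addrC subrK => ->.
  by have := Q0 (z - y); lra.
have hy : h y \is a fin_num.
  rewrite fin_numE gt_eqF//=; apply/eqP => hy.
  by have := ymin _ Yz0; rewrite hy /=; case: (h z0) hz0.
split=> //; split=> // z Yz.
case hz : (h z) (hNy z) => [s| |] // _; last by rewrite leey.
have fz : h z \is a fin_num by rewrite hz.
rewrite -(fineK hy) -EFinD lee_fin dotNl -subr_ge0.
(* Minimality is tested at y + t (z - y). Convexity of [h] and division by t leave the desired
   inequality up to the error t Q (z - y). *)
apply: (@ge0_small_perturb _ _ (Q (z - y))) => t /andP[t0 t1].
have t01 : 0 <= t <= 1 by rewrite ltW.
have [fzt hzt] := @econvex_fine _ _ _ z y t ph ch t01 fz hy.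
have := ymin _ (convex_comb cY t01 Yz Yy).
rewrite -(fineK hy) -(fineK fzt) -!EFinD lee_fin.
move: hzt; rewrite hz /=.
have -> : q (t *: z + (1 - t) *: y) = q (y + t *: (z - y)).
  by congr q; apply/matrixP => i j; rewrite !mxE; ring.
rewrite qE => h1 h2.
rewrite -(pmulr_rge0 _ t0); lra.
Qed.

Lemma ediff_fin (R : realType) (m : nat) (h : 'cV[R]_m -> \bar R) x :
  ediff h x -> h x \is a fin_num.
Proof. by move=> [hx _]; exact: (nbhs_singleton hx). Qed.

Lemma derive_grad (R : realType) (m : nat) (h : 'cV[R]_m -> \bar R)
    (x v : 'cV[R]_m) : ediff h x ->
  'D_v (fun z => fine (h z) : R^o) x = dot (grad h x) v.
Proof.
move=> [_ dh]; rewrite deriveE//.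
rewrite {1}[v]matrix_sum_delta linear_sum; apply: eq_bigr => i _.
by rewrite big_ord1 linearZ/= mxE deriveE// mulrC.
Qed.

(** By convexity the difference quotient towards [z] is at most h z - h x for 0 < t <= 1; its limit
    at 0+ is the directional derivative. This lets the strong convexity in [S0] be applied with the
    gradient. *)
Lemma grad_subgradient (R : realType) (m : nat) (X : set 'cV[R]_m)
    (h : 'cV[R]_m -> \bar R) (x : 'cV[R]_m) :
  Defs.proper h -> econvex h -> ediff h x -> subdiff X h x (grad h x).
Proof.
move=> ph ch dh; have fx := ediff_fin dh; split=> // z _.
case hz : (h z) (ph.1 z) => [s| |] // _; last by rewrite leey.
have fz : h z \is a fin_num by rewrite hz.
rewrite -(fineK fx) -EFinD lee_fin -derive_grad// addrC -lerBrDr.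
have := @diff_derivable _ _ _ _ _ (z - x) dh.2.
rewrite /derivable => /(@cvg_dnbhs_at_right _ _ _ _ _) cvD.
apply: cvgr_to_le cvD _.
near=> t.
have t0 : 0 < t by near: t; exact: nbhs_right_gt.
have t1 : t <= 1 by near: t; exact: nbhs_right_ltW.
have t01 : 0 <= t <= 1 by rewrite ltW.
have [_] := econvex_fine ph ch t01 fz fx.
have -> : t *: z + (1 - t) *: x = t *: (z - x) + x.
  by apply/matrixP => i j; rewrite !mxE; ring.
rewrite hz /= => ht.
rewrite /GRing.scale/= mulrC ler_pdivrMr//; lra.
Unshelve. all: by end_near.
Qed.

Section quadratic_at.
Variables (R : realType) (m : nat).
Implicit Types (q : 'cV[R]_m -> R) (y p z : 'cV[R]_m).

Lemma quadratic_at_dot p y : quadratic_at (dot p) y p.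
Proof. by exists (fun=> 0) => // e t; rewrite dotDr dotZr; ring. Qed.

Lemma quadratic_at_dist (c : R) z y : 0 <= c ->
  quadratic_at (fun u => c * enorm (u - z) ^+ 2) y ((2 * c) *: (y - z)).
Proof.
move=> c0; exists (fun e => c * dot e e) => [e|e t].
  by rewrite mulr_ge0 ?dot_ge0.
rewrite !sqr_enorm !dotE (dotC e y) (dotC e z) (dotC z y); ring.
Qed.

Lemma quadratic_atD q1 q2 y p1 p2 :
  quadratic_at q1 y p1 -> quadratic_at q2 y p2 ->
  quadratic_at (fun z => q1 z + q2 z) y (p1 + p2).
Proof.
move=> [Q1 Q10 E1] [Q2 Q20 E2]; exists (fun e => Q1 e + Q2 e) => [e|e t].
  by rewrite addr_ge0.
by rewrite E1 E2 dotDl; ring.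
Qed.

Lemma quadratic_at_affine (r : nat) (B : 'M[R]_(m, r)) (q : 'cV[R]_m -> R)
    (c p : 'cV[R]_m) (y : 'cV[R]_r) :
  quadratic_at q (B *m y + c) p ->
  quadratic_at (fun u => q (B *m u + c)) y (B^T *m p).
Proof.
move=> [Q Q0 E]; exists (fun e => Q (B *m e)) => [e|e t]; first exact: Q0.
by rewrite mulmxDr -scalemxAr addrAC E dot_trmx.
Qed.

End quadratic_at.

Lemma argmin_shift (R : realType) (T : Type) (S : set T) (phi psi : T -> \bar R)
    (c : R) : (forall z, S z -> phi z = (psi z + c%:E)%E) ->
  argmin S phi = argmin S psi.
Proof.
move=> E; apply/seteqP; split=> z [Sz zmin]; split=> // u Su.
  by have := zmin u Su; rewrite !E// leeD2rE.
by rewrite !E// leeD2rE// zmin.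
Qed.

Lemma indicator_in (R : realType) (T : Type) (S : set T) z :
  S z -> @indicator R T S z = 0%E.
Proof. by rewrite /indicator => Sz; rewrite mem_set. Qed.

(** * Optimality conditions of the subproblems *)

Section optimality.
Variables (R : realType) (m n r : nat) (X : set 'cV[R]_m) (Y : set 'cV[R]_n).
Variables (A : 'M[R]_(r, m)) (B : 'M[R]_(r, n)) (b : 'cV[R]_r).

Lemma linear_prox_optimality (h : 'cV[R]_m -> \bar R) (G z z0 v : 'cV[R]_m)
    (c : R) : 0 <= c ->
  convex_set X -> Defs.proper h -> econvex h -> X z0 -> (h z0 < +oo)%E ->
  argmin X (fun u => h u + (dot G u)%:E + (c * enorm (u - z) ^+ 2)%:E)%E v <->
  X v /\ subdiff X h v (- (G + (2 * c) *: (v - z))).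
Proof.
move=> c0 cX ph ch Xz0 hz0.
rewrite -(argmin_subdiff cX ph ch Xz0 hz0
  (quadratic_atD (quadratic_at_dot G v) (quadratic_at_dist z v c0))).
rewrite (@argmin_shift _ _ _ _
  (fun u => h u + (dot G u + c * enorm (u - z) ^+ 2)%:E)%E 0)//.
by move=> u _; rewrite adde0 EFinD addeA.
Qed.

(** Completing the square: the proximal term centred at z - s G is the one centred at z plus <G, u>,
    up to the constant s/2 |G|^2 - <G, z>. *)
Lemma prox_optimality (h : 'cV[R]_m -> \bar R) (G z z0 v : 'cV[R]_m)
    (s : R) : 0 < s ->
  convex_set X -> Defs.proper h -> econvex h -> X z0 -> (h z0 < +oo)%E ->
  prox X s h (z - s *: G) v <->
  X v /\ subdiff X h v (- (G + s^-1 *: (v - z))).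
Proof.
move=> s0 cX ph ch Xz0 hz0.
have c0 : 0 <= (2 * s)^-1 by rewrite invr_ge0; lra.
have := @linear_prox_optimality h G z z0 v _ c0 cX ph ch Xz0 hz0.
rewrite invfM mulrA divff ?pnatr_eq0// mul1r -invfM => <-.
rewrite /prox (@argmin_shift _ _ _ _
  (fun u => h u + (dot G u)%:E + ((2 * s)^-1 * enorm (u - z) ^+ 2)%:E)%E
  (s / 2 * dot G G - dot G z))//.
move=> u _; rewrite -!addeA -!EFinD; congr (_ + _%:E)%E.
rewrite !sqr_enorm !dotE (dotC G u) (dotC G z) (dotC z u); field; lra.
Qed.

Lemma aug_lagrangian_optimality (f : 'cV[R]_m -> \bar R)
    (g : 'cV[R]_n -> \bar R) (x : 'cV[R]_m) (yt y z0 : 'cV[R]_n)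
    (l : 'cV[R]_r) (sg c : R) : 0 <= c -> 0 <= sg ->
  convex_set Y -> Defs.proper g -> econvex g -> Y z0 -> (g z0 < +oo)%E ->
  X x -> f x \is a fin_num ->
  argmin Y (fun z => aug_lagrangian X Y A B b f g sg x z l
                     + (c * enorm (z - yt) ^+ 2)%:E)%E y <->
  Y y /\ subdiff Y g y
    (- (B^T *m (l + sg *: residual A B b x y) + (2 * c) *: (y - yt))).
Proof.
move=> c0 sg0 cY pg cg Yz0 gz0 Xx fx.
have rE z : residual A B b x z = B *m z + (A *m x - b).
  by rewrite /residual -addrA addrCA.
have sg2 : 0 <= sg / 2 by lra.
have qy : quadratic_at (fun z => dot l (B *m z + (A *m x - b))
      + sg / 2 * enorm (B *m z + (A *m x - b) - 0) ^+ 2 + c * enorm (z - yt) ^+ 2) y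
    (B^T *m (l + sg *: residual A B b x y) + (2 * c) *: (y - yt)).
  apply: quadratic_atD; last exact: quadratic_at_dist.
  apply: (@quadratic_at_affine _ _ _ _ (fun u => dot l u + sg / 2 * enorm (u - 0) ^+ 2)).
  apply: quadratic_atD; first exact: quadratic_at_dot.
  have -> : sg *: residual A B b x y
      = (2 * (sg / 2)) *: (B *m y + (A *m x - b) - 0).
    by rewrite rE subr0; congr (_ *: _); field.
  exact: quadratic_at_dist.
rewrite -(argmin_subdiff cY pg cg Yz0 gz0 qy).
rewrite (@argmin_shift _ _ _ _ (fun z => g z + (dot l (B *m z + (A *m x - b))
      + sg / 2 * enorm (B *m z + (A *m x - b) - 0) ^+ 2
      + c * enorm (z - yt) ^+ 2)%:E)%E (fine (f x)))//.
move=> z Yz; rewrite /aug_lagrangian /lagrangian /objective indicator_in//.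
rewrite adde0 rE subr0 -{1}(fineK fx) -!addeA -!EFinD addeCA.
by congr (_ + _%:E)%E; ring.
Qed.

(* The gradient in [y] of the augmented Lagrangian at [lam_hat] is that of the
   linear term of scheme (H) at the implicit multiplier. *)
Lemma lam_hat_residual (alpha theta : nat -> R) (x v : nat -> 'cV[R]_m)
    (y w : nat -> 'cV[R]_n) (lam : nat -> 'cV[R]_r) (k : nat) :
  0 < alpha k -> 0 < theta k -> theta k = (1 + alpha k) * theta k.+1 ->
  w k.+1 = y k.+1 + (alpha k)^-1 *: (y k.+1 - y k) ->
  lam_hat A B b alpha theta x v y lam k
    + (theta k.+1)^-1 *: residual A B b (x k) (y k.+1) =
  lam k + (alpha k / theta k) *: residual A B b (v k) (w k.+1).
Proof.
move=> al0 th0 thS ->.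
have -> : (theta k.+1)^-1 = (1 + alpha k) / theta k.
  rewrite thS invfM mulrA divff ?mul1r//; lra.
rewrite /lam_hat /residual mulmxBr mulmxDr -scalemxAr mulmxBr.
move: (A *m x k) (A *m v k) (B *m y k) (B *m y k.+1) => ax av by0 by1.
by apply/matrixP => i j; rewrite !mxE; field; lra.
Qed.

End optimality.

(** * One step of the scheme *)

(** The sum of (1 + al) times smoothness, the gradient inequality at x, al times strong convexity,
    al times the subgradient inequality at v', and convexity of f2. Three-point identities turn the
    inner products into squared distances, and strong convexity cancels |xs - u|^2. *)
Lemma x_descent (R : realType) (m : nat) (al mu ga L : R)
    (x v v' xs G l : 'cV[R]_m) (f1x f1u f1s f1x' f2x f2v' f2s f2x' : R) :
  0 < al -> 0 <= mu -> 0 < ga -> 0 <= L ->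
  let u := average al x v in
  let x' := average al x v' in
  let eta := ga + mu * al in
  let p := - (G + l + (eta / al) *:
                (v' - eta^-1 *: (ga *: v + (mu * al) *: u))) in
  f1x' - f1u - dot G (x' - u) <= L / 2 * enorm (x' - u) ^+ 2 ->
  f1u + dot G (x - u) <= f1x ->
  mu / 2 * enorm (xs - u) ^+ 2 <= f1s - f1u - dot G (xs - u) ->
  f2v' + dot p (xs - v') <= f2s ->
  (1 + al) * f2x' <= f2x + al * f2v' ->
  (1 + al) * (f1x' + f2x') - (f1x + f2x) - al * (f1s + f2s) <=
    - al * dot l (v' - xs) - (ga + mu * al) / 2 * enorm (v' - xs) ^+ 2
    + ga / 2 * enorm (v - xs) ^+ 2
    - (ga - L * al ^+ 2) / 2 * enorm (v' - v) ^+ 2.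
Proof.
move=> al0 mu0 ga0 L0 u x' eta p H1 H2 H3 H4 H5.
have a1 : 0 < 1 + al by lra.
have eta0 : 0 < eta by rewrite /eta; nra.
have xE : x = (1 + al) *: u - al *: v.
  by rewrite /u /average scalerA divff ?scale1r ?addrK// gt_eqF.
have [k [k0 ka ak kE]] : exists k,
    [/\ 0 <= k, (1 + al) * k = al, k <= al & k = al / (1 + al)].
  exists (al / (1 + al)); split.
  - by rewrite divr_ge0; lra.
  - by field; lra.
  - by rewrite ler_pdivrMr//; nra.
  - by [].
have x'u : x' - u = k *: (v' - v).
  rewrite /x' /u /average -scalerBr opprD addrACA subrr add0r -scalerBr scalerA.
  by congr (_ *: _); rewrite kE mulrC.
clearbody u x'.
have pE e : al * dot p e = - (al * dot G e + al * dot l e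
    + ga * dot (v' - v) e + mu * al * dot (v' - u) e).
  rewrite -dotZl /p (_ : al *: _ = - (al *: G + al *: l + ga *: (v' - v)
      + (mu * al) *: (v' - u))); first by rewrite !dotE; ring.
  apply/matrixP => i j; rewrite /eta !mxE; field.
  by rewrite -/eta !gt_eqF.
move: H1 H2 H3 H4; rewrite x'u xE => H1 H2 H3 H4.
have {}H1 := ler_wpM2l (ltW a1) H1.
have {}H3 := ler_wpM2l (ltW al0) H3.
have {}H4 := ler_wpM2l (ltW al0) H4.
move: H4; rewrite mulrDr pE => H4.
(* [N0] is the square left over by the three-point identity; [N1] is the slack between the
   smoothness coefficient L al k and the L al^2 of the conclusion. *)
have N0 : 0 <= mu * al * dot (v' - u) (v' - u).
  by rewrite mulr_ge0 ?dot_ge0//; nra.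
have N1 : 0 <= L * (al * (al - k)) * dot (v' - v) (v' - v).
  by rewrite mulr_ge0 ?dot_ge0 ?mulr_ge0//; lra.
have E1 : (1 + al) * (L / 2 * enorm (k *: (v' - v)) ^+ 2) =
    L * (al * k) / 2 * dot (v' - v) (v' - v).
  by rewrite sqr_enorm !dotZl dotZr -[in RHS]ka; field.
have E2 : (1 + al) * (f1x' - f1u - dot G (k *: (v' - v))) =
    (1 + al) * f1x' - (1 + al) * f1u - al * dot G (v' - v).
  by rewrite dotZr; have := congr1 ( *%R^~ (dot G (v' - v))) ka => /=; lra.
rewrite E1 E2 in H1.
clear E1 E2 pE xE x'u kE ka ak k0 eta0.
move: H1 H2 H3 H4 H5 N0 N1.
rewrite !sqr_enorm !dotE.
rewrite (dotC v' v) (dotC u v') (dotC xs v') (dotC xs v) (dotC xs u).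
lra.
Qed.

(** The definitions of eta_g and y_tilde make al p = -(al l + be (w' - w) + mu al (w' - y')). The
    subgradient inequality at y plus al times strong convexity at ys then gives the claim, since y -
    y' = al (y' - w'). *)
Lemma y_descent (R : realType) (n : nat) (al mu be : R)
    (y y' w ys l : 'cV[R]_n) (gy gy' gs : R) :
  0 < al -> 0 <= mu -> 0 < be ->
  let w' := y' + al^-1 *: (y' - y) in
  let eta := (al + 1) * be + mu * al in
  let p := - (l + (2 * (eta / (2 * al ^+ 2))) *:
                (y' - (y + (al * be / eta) *: (w - y)))) in
  gy' + dot p (y - y') <= gy ->
  mu / 2 * enorm (ys - y') ^+ 2 <= gs - gy' - dot p (ys - y') ->
  (1 + al) * gy' - gy - al * gs <=
    - al * dot l (w' - ys) - (be + mu * al) / 2 * enorm (w' - ys) ^+ 2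
    + be / 2 * enorm (w - ys) ^+ 2.
Proof.
move=> al0 mu0 be0 w' eta p H1 H2.
have eta0 : 0 < eta by rewrite /eta; nra.
have yE : y = (1 + al) *: y' - al *: w'.
  by apply/matrixP => i j; rewrite !mxE; field; lra.
have pE e : al * dot p e = - (al * dot l e
    + be * dot (w' - w) e + mu * al * dot (w' - y') e).
  rewrite -dotZl /p (_ : al *: _ = - (al *: l + be *: (w' - w)
      + (mu * al) *: (w' - y'))); first by rewrite !dotE; ring.
  apply/matrixP => i j; rewrite /w' /eta !mxE; field.
  by rewrite -/eta; lra.
have E1 : dot p (y - y') = al * dot p (y' - w').
  by rewrite -dotZr {1}yE; congr dot; apply/matrixP => i j; rewrite !mxE; ring.
rewrite E1 pE in H1.
have {}H2 := ler_wpM2l (ltW al0) H2.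
move: H2; rewrite mulrBr pE => H2.
have N0 : 0 <= mu * al * dot (w' - y') (w' - y').
  by rewrite mulr_ge0 ?dot_ge0//; nra.
have N1 : 0 <= be * dot (w' - w) (w' - w) by rewrite mulr_ge0 ?dot_ge0// ltW.
clear E1 pE yE eta0.
move: H1 H2 N0 N1; clearbody w' p.
rewrite !sqr_enorm !dotE.
rewrite (dotC w' y') (dotC w w') (dotC ys w') (dotC ys y') (dotC ys w) (dotC w y').
lra.
Qed.

(** Feasibility of (xs, ys) gives A (v' - xs) + B (w' - ys) = d, and lb differs from lam' by (al /
    th) A (v' - v). The step-size rule says ga - L al^2 = (al^2 / th) |A|^2, just enough to absorb
    the resulting cross term. *)
Lemma multiplier_descent (R : realType) (m n r : nat) (A : 'M[R]_(r, m))
    (B : 'M[R]_(r, n)) (b ls lam lam' lb d : 'cV[R]_r) (xs v v' : 'cV[R]_m)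
    (ys w' : 'cV[R]_n) (al th L ga : R) :
  0 < al -> 0 < th -> residual A B b xs ys = 0 ->
  (L * th + opnorm A ^+ 2) * al ^+ 2 = ga * th ->
  d = residual A B b v' w' -> lam' = lam + (al / th) *: d ->
  lb = lam + (al / th) *: residual A B b v w' ->
  al * dot ls d + th / 2 * enorm (lam' - ls) ^+ 2 - th / 2 * enorm (lam - ls) ^+ 2
  <= al * dot (A^T *m lb) (v' - xs) + al * dot (B^T *m lb) (w' - ys)
     + (ga - L * al ^+ 2) / 2 * enorm (v' - v) ^+ 2.
Proof.
move=> al0 th0 rs step dE0 lamE lbE0.
have e2 : enorm (A *m (v' - v)) ^+ 2 <= opnorm A ^+ 2 * enorm (v' - v) ^+ 2.
  rewrite -exprMn ler_pXn2r// ?nnegrE ?mulr_ge0 ?enorm_ge0 ?opnorm_ge0//.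
  exact: enorm_mulmx.
have gaE : ga - L * al ^+ 2 = al ^+ 2 / th * opnorm A ^+ 2.
  have -> : ga = (ga * th) / th by field; lra.
  by rewrite -step; field; lra.
have dE : A *m (v' - xs) + B *m (w' - ys) = d.
  rewrite -[RHS]subr0 -rs dE0 /residual !mulmxBr.
  move: (A *m v') (A *m xs) (B *m w') (B *m ys) => p1 p2 p3 p4.
  by apply/matrixP => i j; rewrite !mxE; ring.
have lbE : lb = lam' - (al / th) *: (A *m (v' - v)).
  rewrite lbE0 lamE dE0 /residual mulmxBr.
  move: (A *m v') (A *m v) (B *m w') => p1 p2 p3.
  by apply/matrixP => i j; rewrite !mxE; ring.
have c0 : 0 <= al ^+ 2 / th by rewrite divr_ge0 ?sqr_ge0// ltW.
have {e2} := ler_wpM2l c0 e2.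
(* This square combines the cross term <A (v' - v), d> with |lam' - lam|^2 and |A (v' - v)|^2. *)
have := mulr_ge0 c0 (dot_ge0 (A *m (v' - v) - d)).
rewrite !dot_trmx -mulrDr -dotDr dE gaE lbE lamE.
move: (A *m (v' - v)) => e; move=> {lbE lbE0 lamE dE dE0}.
have : th * (al / th) = al by field; lra.
have : th * (al / th) ^+ 2 = al ^+ 2 / th by field; lra.
have : al * (al / th) = al ^+ 2 / th by field; lra.
move: (al / th) (al ^+ 2 / th) => q c h1 h2 h3.
rewrite !sqr_enorm !dotE (dotC d lam) (dotC ls lam) (dotC d ls) (dotC d e).
have := congr1 ( *%R^~ (dot lam d)) h3.
have := congr1 ( *%R^~ (dot ls d)) h3.
have := congr1 ( *%R^~ (dot d d)) h2.
have := congr1 ( *%R^~ (dot d d)) h1.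
have := congr1 ( *%R^~ (dot e d)) h1.
move=> /=; lra.
Qed.

(** * The Lyapunov function along the iterates *)

Section parameters.
Variables (R : realType) (mu_f mu_g : R) (alpha theta gamma beta : nat -> R).
Hypothesis par : parameters mu_f mu_g alpha theta gamma beta.
Hypotheses (mu_f_ge0 : 0 <= mu_f) (mu_g_ge0 : 0 <= mu_g).

Lemma alpha_gt0 k : 0 < alpha k.
Proof. by case: par => _ _ _ /(_ k) []. Qed.

Let implicit_euler k (a a' mu : R) : (a' - a) / alpha k = mu - a' ->
  (1 + alpha k) * a' = a + mu * alpha k.
Proof.
have al0 := alpha_gt0 k.
by move=> /(congr1 ( *%R^~ (alpha k))); rewrite mulfVK ?gt_eqF//; lra.
Qed.

Lemma thetaS k : theta k = (1 + alpha k) * theta k.+1.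
Proof.
case: par => _ _ _ /(_ k) [_ h _ _].
by rewrite (@implicit_euler k (theta k) _ 0) ?sub0r// mul0r addr0.
Qed.

Lemma gammaS k : (1 + alpha k) * gamma k.+1 = gamma k + mu_f * alpha k.
Proof. by case: par => _ _ _ /(_ k) [_ _ h _]; exact: implicit_euler. Qed.

Lemma betaS k : (1 + alpha k) * beta k.+1 = beta k + mu_g * alpha k.
Proof. by case: par => _ _ _ /(_ k) [_ _ _ h]; exact: implicit_euler. Qed.

Lemma theta_gt0 k : 0 < theta k.
Proof.
elim: k => [|k IH]; first by case: par => ->.
have al0 := alpha_gt0 k; rewrite thetaS in IH.
by rewrite pmulr_rgt0 in IH => //; lra.
Qed.

Lemma gamma_gt0 k : 0 < gamma k.
Proof.
elim: k => [|k IH]; first by case: par.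
have al0 := alpha_gt0 k; have al1 : 0 < 1 + alpha k by lra.
by rewrite -(pmulr_rgt0 _ al1) gammaS ltr_wpDr// mulr_ge0// ltW.
Qed.

Lemma beta_gt0 k : 0 < beta k.
Proof.
elim: k => [|k IH]; first by case: par.
have al0 := alpha_gt0 k; have al1 : 0 < 1 + alpha k by lra.
by rewrite -(pmulr_rgt0 _ al1) betaS ltr_wpDr// mulr_ge0// ltW.
Qed.

Lemma theta_le1 k : theta k <= 1.
Proof.
elim: k => [|k]; first by case: par => ->.
apply: le_trans; have := theta_gt0 k.+1; have := alpha_gt0 k.
by rewrite [leRHS]thetaS; nra.
Qed.

Lemma eta_f_gt0 k : 0 < eta_f mu_f alpha gamma k.
Proof. by rewrite ltr_wpDr ?gamma_gt0// mulr_ge0// ltW ?alpha_gt0. Qed.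

Lemma eta_g_gt0 k : 0 < eta_g mu_g alpha beta k.
Proof.
rewrite ltr_wpDr ?mulr_gt0 ?beta_gt0 ?addr_gt0 ?alpha_gt0// mulr_ge0//.
by rewrite ltW ?alpha_gt0.
Qed.

(** If mu_f > 0, gamma starts at the fixed point mu_f of its recursion and stays there. If mu_f = 0,
    gamma obeys the recursion of theta, hence equals gamma_0 theta. *)
Lemma gamma0_theta_le k : (0 < mu_f -> gamma 0%N = mu_f) ->
  gamma 0%N * theta k <= gamma k <= gamma 0%N /\
  (0 < mu_f -> gamma k = gamma 0%N).
Proof.
move=> gam0.
have g0 := gamma_gt0 0%N.
have [mu0|] := ltP 0 mu_f.
  have gk : gamma k = gamma 0%N.
    elim: k => [//|k IH]; have := gammaS k; rewrite IH gam0//.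
    have al0 := alpha_gt0 k => h.
    apply: (@mulfI _ (1 + alpha k)); first by rewrite gt_eqF; lra.
    by rewrite h; ring.
  by rewrite gk lexx ler_piMr ?theta_le1 ?ltW.
move=> mu0; have {}mu0 : mu_f = 0 by apply/eqP; rewrite eq_le mu0.
suff -> : gamma k = gamma 0%N * theta k.
  by rewrite lexx ler_piMr ?theta_le1 ?ltW// mu0 ltxx.
elim: k => [|k IH]; first by case: par => ->; rewrite mulr1.
have al0 := alpha_gt0 k.
apply: (@mulfI _ (1 + alpha k)); first by rewrite gt_eqF; lra.
by rewrite gammaS mu0 mul0r addr0 IH thetaS; ring.
Qed.

Lemma theta_rate_bound (L a : R) : 0 <= a -> mu_f <= L ->
  (0 < mu_f -> gamma 0%N = mu_f) ->
  (forall k, (L * theta k + a ^+ 2) * alpha k ^+ 2 = gamma k * theta k) ->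
  gamma 0%N <= L + a ^+ 2 ->
  forall k, (1 <= k)%N ->
  ((theta k)%:E <= 36%:E * theta_rate a mu_f L (gamma 0%N) k)%E.
Proof.
move=> a0 muL gam0 step gaL k k1.
have L0 : 0 <= L := le_trans mu_f_ge0 muL.
have g0 := gamma_gt0 0%N.
have th0 : theta 0%N = 1 by case: par.
(* gamma_j <= gamma_0 <= L + a^2 and theta_j <= 1 give gamma_j theta_j <= L theta_j + a^2, and the
   step-size rule turns this into alpha_j^2 <= 1. *)
have al01 j : 0 < alpha j <= 1.
  rewrite alpha_gt0/=.
  have [/andP[_ gj] _] := @gamma0_theta_le j gam0.
  have tj := theta_gt0 j; have tj1 := theta_le1 j.
  have := step j; have gj0 := gamma_gt0 j.
  set D := L * _ + _ => sj.
  have D0 : 0 < D.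
    have : 0 < D * alpha j ^+ 2 by rewrite sj mulr_gt0.
    by rewrite pmulr_lgt0// exprn_gt0// alpha_gt0.
  apply: le_of_sqr; rewrite // expr1n.
  rewrite -(ler_pM2l D0) sj mulr1.
  apply: (@le_trans _ _ ((L + a ^+ 2) * theta j)).
    by rewrite ler_wpM2r// ?(ltW tj)// (le_trans gj).
  by rewrite /D mulrDl lerD2l ler_piMr ?sqr_ge0.
have B1 := @theta_sublinear _ a L (gamma 0%N) theta alpha a0 L0 g0
  theta_gt0 al01 thetaS.
have B2 := @theta_exponential _ a L (gamma 0%N) theta alpha a0 L0 g0 th0
  theta_gt0 al01 thetaS.
rewrite /theta_rate; set e1 := (X in mine X _); set e2 := (X in mine _ X).
have [h|h] := leP e1 e2.
  rewrite -EFinM lee_fin; apply: B1 => // j.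
  have [/andP[gj _] _] := @gamma0_theta_le j gam0.
  by rewrite step expr2 mulrA ler_wpM2r// ltW ?theta_gt0.
(* For mu_f = 0 this argument of the minimum is [+oo] and the bound is trivial. *)
rewrite /e2 => {h e2}; have [mu0|mu0] := eqVneq mu_f 0.
  by rewrite addye// gt0_muley ?leey// lte_fin.
have mu1 : 0 < mu_f by rewrite lt_def mu0.
rewrite -EFinD -EFinM lee_fin -(gam0 mu1).
apply: B2 => //; first exact: lt_le_trans muL.
by move=> j; rewrite step (@gamma0_theta_le j gam0).2.
Qed.

End parameters.

Lemma fin_numD_proper (R : realType) (a c : \bar R) :
  (-oo < a)%E -> (-oo < c)%E -> (a + c)%E \is a fin_num ->
  a \is a fin_num /\ c \is a fin_num.
Proof. by case: a => [?| |] //; case: c. Qed.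

(** * Equivalence of the scheme and the algorithm *)

Section primal_dual.
Variables (R : realType) (m n r : nat).
Variables (X : set 'cV[R]_m) (Y : set 'cV[R]_n).
Variables (A : 'M[R]_(r, m)) (B : 'M[R]_(r, n)) (b : 'cV[R]_r).
Variables (f f1 f2 : 'cV[R]_m -> \bar R) (g : 'cV[R]_n -> \bar R).
Variables (xs : 'cV[R]_m) (ys : 'cV[R]_n) (lams : 'cV[R]_r).
Variables (L mu_f mu_g : R) (alpha theta gamma beta : nat -> R).
Variables (x v : nat -> 'cV[R]_m) (y w : nat -> 'cV[R]_n).
Variables (lam lamb : nat -> 'cV[R]_r).
Hypotheses (cX : convex_set X) (cY : convex_set Y).
Hypotheses (ccf : proper_closed_convex f) (ccg : proper_closed_convex g).
Hypothesis sad : saddle_point X Y A B b f g xs ys lams.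
Hypotheses (mu_g_ge0 : 0 <= mu_g) (mu_f_ge0 : 0 <= mu_f) (mu_f_le : mu_f <= L).
Hypothesis fE : forall z, f z = (f1 z + f2 z)%E.
Hypotheses (Sf2 : S0 0 X f2) (Sf1 : S11 mu_f L X f1).
Hypothesis par : parameters mu_f mu_g alpha theta gamma beta.
Hypotheses (Xx0 : X (x 0%N)) (Xv0 : X (v 0%N)).

Let al0 k : 0 < alpha k. Proof. exact: alpha_gt0 par k. Qed.
Let th0 k : 0 < theta k. Proof. exact: theta_gt0 par k. Qed.
Let ga0 k : 0 < gamma k. Proof. exact: gamma_gt0 par mu_f_ge0 k. Qed.
Let be0 k : 0 < beta k. Proof. exact: beta_gt0 par mu_g_ge0 k. Qed.
Let ef0 k : 0 < eta_f mu_f alpha gamma k.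
Proof. exact: eta_f_gt0 par mu_f_ge0 k. Qed.
Let eg0 k : 0 < eta_g mu_g alpha beta k.
Proof. exact: eta_g_gt0 par mu_g_ge0 k. Qed.

Let pf : Defs.proper f. Proof. by case: ccf. Qed.
Let cf : econvex f. Proof. by case: ccf. Qed.
Let pg : Defs.proper g. Proof. by case: ccg. Qed.
Let cg : econvex g. Proof. by case: ccg. Qed.
Let pf1 : Defs.proper f1. Proof. by case: Sf1 => -[[]]. Qed.
Let cf1 : econvex f1. Proof. by case: Sf1 => -[[]]. Qed.
Let pf2 : Defs.proper f2. Proof. by case: Sf2 => -[]. Qed.
Let cf2 : econvex f2. Proof. by case: Sf2 => -[]. Qed.
Let df1 z : X z -> ediff f1 z. Proof. by case: Sf1 => _ + _; exact. Qed.
Let f1_fin z : X z -> f1 z \is a fin_num.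
Proof. by move=> /df1; exact: ediff_fin. Qed.

Let f_fin z : X z -> (f z \is a fin_num) = (f2 z \is a fin_num).
Proof. by move=> /f1_fin fz; rewrite fE fin_numD fz. Qed.

Let fine_f z : X z -> f2 z \is a fin_num ->
  fine (f z) = fine (f1 z) + fine (f2 z).
Proof. by move=> Xz f2z; rewrite fE fineD// f1_fin. Qed.

Let Xs : X xs. Proof. by case: sad. Qed.
Let Ys : Y ys. Proof. by case: sad. Qed.

Let fs_gs_fin : f xs \is a fin_num /\ g ys \is a fin_num.
Proof.
by case: sad => _ _ h _; apply: fin_numD_proper h; [exact: pf.1|exact: pg.1].
Qed.

Let f2s_fin : f2 xs \is a fin_num.
Proof. by rewrite -f_fin//; case: fs_gs_fin. Qed.

Let gs_lty : (g ys < +oo)%E. 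
Proof.
by case: fs_gs_fin => _; rewrite fin_numE => /andP[_]; rewrite ltey.
Qed.

Let f2s_lty : (f2 xs < +oo)%E. 
Proof. by have := f2s_fin; rewrite fin_numE => /andP[_]; rewrite ltey. Qed.

Let average_in k z : X (x k) -> X z -> X (average (alpha k) (x k) z).
Proof.
by move=> Xx Xz; have [t01 ->] := average_comb (x k) z (al0 k); exact: convex_comb.
Qed.

Definition v_opt k := X (v k.+1) /\ subdiff X f2 (v k.+1)
  (- (grad f1 (u_pt alpha x v k) + A^T *m lamb k.+1
      + (eta_f mu_f alpha gamma k / alpha k)
          *: (v k.+1 - v_tilde mu_f alpha gamma x v k))).

Definition y_opt k := Y (y k.+1) /\ subdiff Y g (y k.+1)
  (- (B^T *m lamb k.+1 + (2 * (eta_g mu_g alpha beta k / (2 * alpha k ^+ 2)))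
          *: (y k.+1 - y_tilde mu_g alpha beta y w k))).

Let c_ge0 k : 0 <= eta_g mu_g alpha beta k / (2 * alpha k ^+ 2).
Proof. by rewrite divr_ge0 ?mulr_ge0 ?sqr_ge0// ltW. Qed.

(** The common first-order form to which the steps of both schemes reduce. *)
Definition scheme_step k := [/\ v_opt k, x k.+1 = average (alpha k) (x k) (v k.+1),
  y_opt k, w k.+1 = y k.+1 + (alpha k)^-1 *: (y k.+1 - y k) &
  lam k.+1 = lam k + (alpha k / theta k) *: residual A B b (v k.+1) (w k.+1)].

Local Notation schemeH := (scheme_H X Y A B b f1 f2 g mu_f mu_g
  alpha theta gamma beta x v y w lam lamb).
Local Notation choice := (multiplier_choice A B b alpha theta v w lam lamb).
Local Notation algo := (algorithm X Y A B b f f1 f2 g mu_f mu_g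
  alpha theta gamma beta x v y w lam lamb).

(** The saddle point supplies the points of X and Y at which f2 and g are finite, as the optimality
    conditions require. *)
Lemma scheme_H_optimality : schemeH <-> forall k, scheme_step k.
Proof.
have vE k : argmin X (fun z => f2 z
        + (dot (grad f1 (u_pt alpha x v k) + A^T *m lamb k.+1) z)%:E
        + (eta_f mu_f alpha gamma k / (2 * alpha k)
             * enorm (z - v_tilde mu_f alpha gamma x v k) ^+ 2)%:E)%E (v k.+1)
     <-> v_opt k.
  have c0 : 0 <= eta_f mu_f alpha gamma k / (2 * alpha k).
    by rewrite divr_ge0 ?mulr_ge0// ltW.
  rewrite (linear_prox_optimality _ _ _ c0 cX pf2 cf2 Xs f2s_lty).
  rewrite /v_opt (_ : 2 * _ = eta_f mu_f alpha gamma k / alpha k)//.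
  by field; rewrite gt_eqF.
have yE k : argmin Y (fun z => g z + (dot (B *m z) (lamb k.+1))%:E
        + (eta_g mu_g alpha beta k / (2 * alpha k ^+ 2)
             * enorm (z - y_tilde mu_g alpha beta y w k) ^+ 2)%:E)%E (y k.+1)
     <-> y_opt k.
  rewrite /y_opt -(linear_prox_optimality _ _ _ (c_ge0 k) cY pg cg Ys gs_lty).
  rewrite (_ : (fun z => g z + (dot (B *m z) _)%:E + _)%E =
      (fun z => g z + (dot (B^T *m lamb k.+1) z)%:E
        + (eta_g mu_g alpha beta k / (2 * alpha k ^+ 2)
             * enorm (z - y_tilde mu_g alpha beta y w k) ^+ 2)%:E)%E)//.
  by apply/funext => z; rewrite dot_trmx dotC.
split=> h k; have [h1 h2 h3 h4 h5] := h k; split=> //.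
- exact/vE.
- exact/yE.
- exact/vE.
- exact/yE.
Qed.

Let prox_v_opt k :
  prox X (alpha k / eta_f mu_f alpha gamma k) f2
    (v_tilde mu_f alpha gamma x v k
       - (alpha k / eta_f mu_f alpha gamma k)
           *: (grad f1 (u_pt alpha x v k) + A^T *m lamb k.+1)) (v k.+1)
  <-> v_opt k.
Proof.
have s0 : 0 < alpha k / eta_f mu_f alpha gamma k by rewrite divr_gt0.
rewrite (prox_optimality _ _ _ s0 cX pf2 cf2 Xs f2s_lty).
by rewrite invf_div.
Qed.

Let aug_y_opt k : X (x k) -> f (x k) \is a fin_num ->
  w k.+1 = y k.+1 + (alpha k)^-1 *: (y k.+1 - y k) ->
  lamb k.+1 = lam k + (alpha k / theta k) *: residual A B b (v k) (w k.+1) ->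
  argmin Y (fun z =>
        aug_lagrangian X Y A B b f g (theta k.+1)^-1 (x k) z
          (lam_hat A B b alpha theta x v y lam k)
        + (eta_g mu_g alpha beta k / (2 * alpha k ^+ 2)
             * enorm (z - y_tilde mu_g alpha beta y w k) ^+ 2)%:E)%E (y k.+1)
  <-> y_opt k.
Proof.
move=> Xx fx wE lE.
have sg0 : 0 <= (theta k.+1)^-1 by rewrite invr_ge0 ltW.
rewrite (aug_lagrangian_optimality _ _ _ _ _ _ (c_ge0 k) sg0 cY pg cg Ys gs_lty Xx fx).
by rewrite (lam_hat_residual _ _ _ _ _ _ _ (th0 k) (thetaS par k) wE)// -lE.
Qed.

Lemma scheme_H_algorithm : schemeH /\ choice -> algo.
Proof.
move=> [/scheme_H_optimality sH ch] k s.
have Xxv j : X (x j) /\ X (v j).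
  elim: j => [|j [Xx Xv]]; first by [].
  have [[Xv' _] -> _ _ _] := sH j; split=> //; exact: average_in.
have [hv hx hy hw hl] := sH k.
have [Xx _] := Xxv k.
split=> //; last by split=> //; exact/prox_v_opt.
have [fx|] := boolP (f (x k) \is a fin_num); first exact/aug_y_opt.
(* With f (x_k) infinite the objective of the y-step is [+oo] on all of Y, so every point of Y
   minimizes it. *)
move=> fNfin; have fy : f (x k) = +oo%E.
  by move: (pf.1 (x k)) fNfin; case: (f (x k)).
split; first by case: hy.
move=> z Yz; rewrite /aug_lagrangian /lagrangian /objective fy !indicator_in//.
- by case: (g z) (pg.1 z) => //= *; rewrite leey.
- by split=> //; case: hy.
Qed.

Lemma algorithm_in : algo -> forall k, [/\ X (x k), X (v k) & ((1 <= k)%N -> Y (y k))].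
Proof.
move=> al; elim=> [|k [Xx Xv _]]; first by [].
have [[Yy _] _ _ [[Xv' _] -> _]] := al k.
by split=> //; exact: average_in.
Qed.

(** f2 is finite at v_{k+1}, where it has a subgradient, and x_{k+1} is a convex combination of x_k
    and v_{k+1}. *)
Lemma scheme_f_fin k : X (x k) -> f (x k) \is a fin_num -> scheme_step k ->
  f (x k.+1) \is a fin_num.
Proof.
move=> Xx fx [[Xv [f2v _]] -> _ _ _].
have [t01 ->] := average_comb (x k) (v k.+1) (al0 k).
have fv : f (v k.+1) \is a fin_num by rewrite f_fin.
by have [] := econvex_fine pf cf t01 fx fv.
Qed.

(** Finiteness of f (x_k) is carried through the induction: it is needed to read off the y-step, and
    the step passes it on to x_{k+1}. *)
Lemma algorithm_optimality : f (x 0%N) \is a fin_num -> algo ->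
  choice /\ forall k, scheme_step k /\ f (x k) \is a fin_num.
Proof.
move=> fx0 al; split=> [k|]; first by case: (al k).
have step k : f (x k) \is a fin_num -> scheme_step k.
  move=> fx; have [hy hw hl [hv hx hlam]] := al k.
  have [Xx _ _] := algorithm_in al k.
  by split=> //; [exact/prox_v_opt|exact/aug_y_opt].
elim=> [|k [IH fx]]; first by split=> //; exact: step.
have [Xx _ _] := algorithm_in al k.
have fx' := scheme_f_fin Xx fx IH.
by split=> //; exact: step.
Qed.

Lemma algorithm_scheme_H : (f (x 0%N) < +oo)%E -> algo -> schemeH /\ choice.
Proof.
move=> fx0 al.
have ffin : f (x 0%N) \is a fin_num.
  by rewrite fin_numE gt_eqF ?pf.1//= lt_eqF.
have [ch st] := algorithm_optimality ffin al.
by split=> //; apply/scheme_H_optimality => k; case: (st k).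
Qed.

(** * The saddle point and the real-valued Lyapunov function *)

Local Notation rs k := (residual A B b (x k) (y k)).

(** Testing the multiplier inequality at lams plus the residual gives |residual|^2 <= 0. *)
Lemma residual_saddle : residual A B b xs ys = 0.
Proof.
case: sad => _ _ Fs /(_ xs ys (lams + residual A B b xs ys)) [+ _].
rewrite /lagrangian !indicator_in// adde0 leeD2lE// lee_fin dotDl gerDl => h.
by apply/eqP; rewrite -dot_eq0 eq_le h dot_ge0.
Qed.

Local Notation Fs := (fine (f xs) + fine (g ys)).

Let objective_saddle : objective f g xs ys = Fs%:E.
Proof. by have [fx gy] := fs_gs_fin; rewrite /objective EFinD !fineK. Qed.

Let lagrangian_saddle l : lagrangian X Y A B b f g xs ys l = Fs%:E.
Proof.
rewrite /lagrangian indicator_in// adde0 objective_saddle residual_saddle.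
by rewrite -(scale0r 0) dotZr mul0r adde0.
Qed.

(** Under this condition the Lyapunov function is the real number [energy k]; otherwise it is
    [+oo]. *)
Definition in_dom k := [/\ X (x k), Y (y k), f (x k) \is a fin_num & g (y k) \is a fin_num].

Definition gap k := fine (f (x k)) + fine (g (y k)) - Fs + dot lams (rs k).

Lemma gap_ge0 k : in_dom k -> 0 <= gap k.
Proof.
move=> [Xx Yy fx gy]; case: sad => _ _ _ /(_ (x k) (y k) 0) [_].
rewrite lagrangian_saddle /lagrangian indicator_in// adde0 /objective.
by rewrite -(fineK fx) -(fineK gy) -!EFinD lee_fin /gap; lra.
Qed.

Definition energy k := gap k + gamma k / 2 * enorm (v k - xs) ^+ 2
  + beta k / 2 * enorm (w k - ys) ^+ 2 + theta k / 2 * enorm (lam k - lams) ^+ 2.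

Local Notation E :=
  (lyapunov X Y A B b f g theta gamma beta xs ys lams x v y w lam).

Lemma lyapunov_fin k : in_dom k -> E k = (energy k)%:E.
Proof.
move=> [Xx Yy fx gy]; rewrite /lyapunov lagrangian_saddle /lagrangian.
rewrite indicator_in// adde0 /objective -(fineK fx) -(fineK gy) -!EFinD.
by congr (_%:E); rewrite /energy /gap /=; lra.
Qed.

Lemma lyapunov_infinite k : ~ in_dom k -> E k = +oo%E.
Proof.
move=> dom; suff : lagrangian X Y A B b f g (x k) (y k) lams = +oo%E.
  by rewrite /lyapunov => ->; rewrite lagrangian_saddle.
have fN := pf.1 (x k); have gN := pg.1 (y k).
rewrite /lagrangian /objective /indicator.
have [xy|xy] := boolP (_ \in _); last by case: (f _) (g _) fN gN => [?| |] [?| |].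
move: xy; rewrite inE => -[/= Xx Yy].
move: dom; rewrite /in_dom.
case: (f _) (g _) fN gN => [?| |] [?| |] //= _ _ h.
by exfalso; exact: h.
Qed.

Lemma energy_ge k : in_dom k ->
  [/\ 0 <= energy k, gap k <= energy k
    & theta k / 2 * enorm (lam k - lams) ^+ 2 <= energy k].
Proof.
move=> /gap_ge0 h; rewrite /energy.
have h1 : 0 <= gamma k / 2 * enorm (v k - xs) ^+ 2.
  by rewrite mulr_ge0 ?sqr_ge0// divr_ge0// ltW.
have h2 : 0 <= beta k / 2 * enorm (w k - ys) ^+ 2.
  by rewrite mulr_ge0 ?sqr_ge0// divr_ge0// ltW.
have h3 : 0 <= theta k / 2 * enorm (lam k - lams) ^+ 2.
  by rewrite mulr_ge0 ?sqr_ge0// divr_ge0// ltW.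
split; lra.
Qed.

(** (1 + alpha) x_{k+1} = x_k + alpha v_{k+1}, and likewise for y and w; the residual is affine and
    the weights of [b] agree. *)
Let residual_average k :
  x k.+1 = average (alpha k) (x k) (v k.+1) ->
  w k.+1 = y k.+1 + (alpha k)^-1 *: (y k.+1 - y k) ->
  (1 + alpha k) *: rs k.+1 = rs k + alpha k *: residual A B b (v k.+1) (w k.+1).
Proof.
have a0 := al0 k; move=> xE wE.
have xE' : (1 + alpha k) *: (A *m x k.+1) = A *m x k + alpha k *: (A *m v k.+1).
  rewrite scalemxAr xE /average scalerA divff ?gt_eqF ?addr_gt0//.
  by rewrite scale1r mulmxDr scalemxAr.
have wE' : alpha k *: (B *m w k.+1) = (1 + alpha k) *: (B *m y k.+1) - B *m y k.
  rewrite !scalemxAr wE -mulmxBr; congr (_ *m _).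
  by apply/matrixP => i j; rewrite !mxE; field; lra.
rewrite /residual scalerDr scalerDr xE' [RHS]addrC scalerDr scalerDr wE'.
move: (A *m _) (A *m _) (B *m _) (B *m _) => p1 p2 p3 p4.
by apply/matrixP => i j; rewrite !mxE; ring.
Qed.

(** * Energy decay, feasibility and objective bounds *)

Hypothesis Sg : S0 mu_g Y g.
Hypothesis stepsize :
  forall k, (L * theta k + opnorm A ^+ 2) * alpha k ^+ 2 = gamma k * theta k.

(** The sum of [x_descent], [y_descent] and [multiplier_descent]: the inner products with the
    implicit multiplier cancel, and so do the multiples of |v_{k+1} - v_k|^2. *)
Lemma energy_step k : in_dom k -> X (v k) -> scheme_step k -> choice ->
  in_dom k.+1 /\ (1 + alpha k) * energy k.+1 <= energy k.
Proof.
move=> dom Xv st ch; have [Xx Yy fx gy] := dom.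
have fx' := scheme_f_fin Xx fx st.
have [[Xv' [f2v' subf2]] xE [Yy' [gy' subg]] wE lamE] := st.
have Xx' : X (x k.+1) by rewrite xE; exact: average_in.
have dom' : in_dom k.+1 by [].
split=> //.
have Xu : X (u_pt alpha x v k) by exact: average_in.
have a0 := al0 k.
have [fs gs] := fs_gs_fin.
have L0 : 0 <= L := le_trans mu_f_ge0 mu_f_le.
have f2x : f2 (x k) \is a fin_num by rewrite -f_fin.
have f2x' : f2 (x k.+1) \is a fin_num by rewrite -f_fin.
have /f1_fin f1x := Xx; have /f1_fin f1x' := Xx'; have /f1_fin f1u := Xu.
have /f1_fin f1s := Xs.
have H1 : fine (f1 (x k.+1)) - fine (f1 (u_pt alpha x v k))
      - dot (grad f1 (u_pt alpha x v k)) (x k.+1 - u_pt alpha x v k)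
    <= L / 2 * enorm (x k.+1 - u_pt alpha x v k) ^+ 2.
  case: Sf1 => _ _ /(_ _ _ Xx' Xu).
  by rewrite -{1}(fineK f1x') -{1}(fineK f1u) -!EFinB lee_fin.
have subu := grad_subgradient X pf1 cf1 (df1 Xu).
have H2 : fine (f1 (u_pt alpha x v k))
      + dot (grad f1 (u_pt alpha x v k)) (x k - u_pt alpha x v k)
    <= fine (f1 (x k)).
  by case: subu => _ /(_ _ Xx); rewrite -{1}(fineK f1u) -{1}(fineK f1x) -EFinD lee_fin.
have H3 : mu_f / 2 * enorm (xs - u_pt alpha x v k) ^+ 2
    <= fine (f1 xs) - fine (f1 (u_pt alpha x v k))
       - dot (grad f1 (u_pt alpha x v k)) (xs - u_pt alpha x v k).
  case: Sf1 => -[_ /(_ _ _ _ Xs Xu subu)] + _ _.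
  by rewrite -{1}(fineK f1s) -{1}(fineK f1u) -!EFinB lee_fin.
have H4 := subf2 _ Xs.
rewrite -(fineK f2v') -(fineK f2s_fin) -EFinD lee_fin in H4.
have H5 : (1 + alpha k) * fine (f2 (x k.+1))
    <= fine (f2 (x k)) + alpha k * fine (f2 (v k.+1)).
  have [t01 aE] := average_comb (x k) (v k.+1) a0.
  have [_] := econvex_fine pf2 cf2 t01 f2x f2v'.
  rewrite -aE -xE; have a1 : 0 < 1 + alpha k by lra.
  move=> /(ler_wpM2l (ltW a1)).
  rewrite mulrDr !mulrA mulrBr mulr1 divff ?gt_eqF// mul1r.
  by rewrite (_ : 1 + alpha k - 1 = alpha k)//; ring.
have HX := @x_descent R m (alpha k) mu_f (gamma k) L (x k) (v k) (v k.+1) xs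
  (grad f1 (u_pt alpha x v k)) (A^T *m lamb k.+1) _ _ _ _ _ _ _ _
  a0 mu_f_ge0 (ga0 k) L0.
move: HX; rewrite -xE => HX.
have {H1 H2 H3 H4 H5} HX := HX _ _ _ _ _ _ _ _ H1 H2 H3 H4 H5.
have G1 := subg _ Yy.
rewrite -(fineK gy') -(fineK gy) -EFinD lee_fin in G1.
have subg' := conj gy' subg.
have G2 := (Sg.2 ys (y k.+1) _ Ys Yy' subg').
rewrite -(fineK gs) -(fineK gy') -!EFinB lee_fin in G2.
have HY := @y_descent R n (alpha k) mu_g (beta k) (y k) (y k.+1) (w k) ys
  (B^T *m lamb k.+1) _ _ _ a0 mu_g_ge0 (be0 k) G1 G2.
rewrite -wE in HY.
have HL := multiplier_descent lams a0 (th0 k) residual_saddle (stepsize k)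
  erefl lamE (ch k).
(* Paired with lams, the residual recursion matches the feasibility part of the gap with the term
   [dot ls d] of [multiplier_descent]. *)
have rE := congr1 (dot lams) (residual_average xE wE).
rewrite dotZr dotDr dotZr in rE.
have gS := gammaS par k; have bS := betaS par k; have tS := thetaS par k.
(* The parameter recursions, multiplied by the squared distances, leave a goal linear in the
   products. *)
have E1 := congr1 ( *%R^~ (enorm (v k.+1 - xs) ^+ 2)) gS.
have E2 := congr1 ( *%R^~ (enorm (w k.+1 - ys) ^+ 2)) bS.
have E3 := congr1 ( *%R^~ (enorm (lam k.+1 - lams) ^+ 2)) tS.
rewrite /= in E1 E2 E3.
rewrite /energy /gap (fine_f Xx f2x) (fine_f Xx' f2x') (fine_f Xs f2s_fin).
lra.
Qed.

Hypothesis al : algo.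

Lemma energy_decay : in_dom 0%N ->
  forall k, in_dom k /\ energy k <= theta k * energy 0%N.
Proof.
move=> dom0; have [_ _ fx0 _] := dom0.
have [ch st] := algorithm_optimality fx0 al.
elim=> [|k [dom IH]]; first by case: par => -> *; rewrite mul1r.
have [Xx Xv _] := algorithm_in al k.
have [dom' h] := energy_step dom Xv (st k).1 ch.
split=> //; have a1 : 0 < 1 + alpha k by have := al0 k; lra.
by rewrite -(ler_pM2l a1) mulrA -(thetaS par) (le_trans h).
Qed.

(** Dividing the residual recursion by theta_k, with (1 + alpha_k) / theta_k = 1 / theta_{k+1},
    makes its increment exactly lam_{k+1} - lam_k. *)
Lemma multiplier_residual : in_dom 0%N -> forall k,
  (theta k)^-1 *: rs k = lam k - lam 0%N + rs 0%N.
Proof.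
move=> [_ _ fx0 _]; have [ch st] := algorithm_optimality fx0 al.
elim=> [|k IH]; first by case: par => -> *; rewrite invr1 scale1r subrr add0r.
have [[_ xE _ wE lamE] _] := st k.
have : (theta k)^-1 *: ((1 + alpha k) *: rs k.+1) = (theta k)^-1 *: rs k
    + (theta k)^-1 *: (alpha k *: residual A B b (v k.+1) (w k.+1)).
  by rewrite residual_average// [LHS]scalerDr.
rewrite IH !scalerA [_ * (1 + _)]mulrC [_ * alpha k]mulrC.
have -> : (1 + alpha k) / theta k = (theta k.+1)^-1.
  rewrite (thetaS par k) invfM mulrA divff ?mul1r// gt_eqF//.
  by have := al0 k; lra.
move=> ->; rewrite lamE.
move: (rs 0%N) (residual A B b (v k.+1) (w k.+1)) => p1 p2.
by apply/matrixP => i j; rewrite !mxE; ring.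
Qed.

Local Notation R0 :=
  (Num.sqrt (2 * energy 0%N) + enorm (lam 0%N - lams) + enorm (rs 0%N)).

(** The factor theta_k cancels in theta_k / 2 |lam_k - lams|^2 <= theta_k E_0, so the multipliers
    stay bounded; [multiplier_residual] transfers this to the residual. *)
Lemma residual_bound : in_dom 0%N -> forall k, enorm (rs k) <= theta k * R0.
Proof.
move=> dom0 k.
have [dom Ek] := energy_decay dom0 k.
have [E0 _ _] := energy_ge dom0.
have [_ _ lk] := energy_ge dom.
have t0 := th0 k.
have hl : enorm (lam k - lams) <= Num.sqrt (2 * energy 0%N).
  have q0 : 0 <= 2 * energy 0%N by rewrite mulr_ge0.
  apply: le_of_sqr; rewrite ?sqrtr_ge0// (sqr_sqrtr q0).
  rewrite -(ler_pM2l t0).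
  by have := le_trans lk Ek; lra.
have -> : rs k = theta k *: (lam k - lam 0%N + rs 0%N).
  by rewrite -multiplier_residual// scalerA divff ?scale1r ?gt_eqF.
rewrite enormZ gtr0_norm// ler_wpM2l ?(ltW t0)//.
apply: le_trans (enormD _ _) _; rewrite lerD2r.
rewrite (_ : lam k - lam 0%N = (lam k - lams) - (lam 0%N - lams)); last first.
  by rewrite opprB addrA subrK.
apply: le_trans (enormD _ _) _; rewrite enormN.
exact: lerD.
Qed.

(** The objective difference is the gap, which lies between 0 and theta_k E_0, minus <lams,
    residual>, which Cauchy-Schwarz controls. *)
Lemma objective_bound : in_dom 0%N -> forall k,
  `|fine (f (x k)) + fine (g (y k)) - Fs| <= theta k * (energy 0%N + enorm lams * R0).
Proof.
move=> dom0 k.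
have [dom Ek] := energy_decay dom0 k.
have [_ gE _] := energy_ge dom.
have g0 := gap_ge0 dom.
have h := ler_wpM2l (enorm_ge0 lams) (residual_bound dom0 k).
have := le_trans (cauchy_schwarz lams (rs k)) h.
rewrite !ler_norml => /andP[h1 h2].
move: g0 gE; rewrite {1 2}/gap => g0 gE; apply/andP; split; lra.
Qed.

Lemma lyapunov_decay k : (E k <= (theta k)%:E * E 0%N)%E.
Proof.
(* Outside the domain E_0 = [+oo], and theta_k > 0 makes the bound trivial. *)
have [dom0|dom0] := pselect (in_dom 0%N); last first.
  by rewrite (lyapunov_infinite dom0) gt0_muley ?leey// lte_fin.
have [dom Ek] := energy_decay dom0 k.
by rewrite !lyapunov_fin// -EFinM lee_fin.
Qed.

Local Notation eR0 := (sqrte (2%:E * E 0%N) + (enorm (lam 0%N - lams))%:E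
  + (enorm (rs 0%N))%:E)%E.

Lemma residual_decay k : ((enorm (rs k))%:E <= (theta k)%:E * eR0)%E.
Proof.
have [dom0|dom0] := pselect (in_dom 0%N).
  by rewrite lyapunov_fin//= lee_fin; exact: residual_bound.
rewrite (lyapunov_infinite dom0) (@gt0_muley _ 2%:E) ?lte_fin//=.
by rewrite !addye// gt0_muley ?leey// lte_fin.
Qed.

Lemma objective_decay k :
  (`|objective f g (x k) (y k) - objective f g xs ys|
     <= (theta k)%:E * (E 0%N + (enorm lams)%:E * eR0))%E.
Proof.
have [dom0|dom0] := pselect (in_dom 0%N).
  have [[_ _ fx gy] _] := energy_decay dom0 k.
  rewrite objective_saddle /objective -(fineK fx) -(fineK gy).
  by rewrite lyapunov_fin//= lee_fin; exact: objective_bound.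
(* The product is 0 if lams = 0 and [+oo] otherwise; excluding [-oo] lets the infinite E_0 absorb
   it. *)
have lamy : ((enorm lams)%:E * +oo != -oo)%E.
  by rewrite gt_eqF// (lt_le_trans ltNy0)// mule_ge0// lee_fin enorm_ge0.
rewrite (lyapunov_infinite dom0) (@gt0_muley _ 2%:E) ?lte_fin//= !addye//.
by rewrite gt0_muley ?leey// lte_fin.
Qed.

End primal_dual.

Unset Implicit Arguments.

Theorem theorem4p2 (R : realType) (L_f : R) (hL_f : 0 <= L_f) :
  exists2 C : R, 0 < C &
  forall (m n r : nat) (X : set 'cV[R]_m) (Y : set 'cV[R]_n)
    (A : 'M[R]_(r, m)) (B : 'M[R]_(r, n)) (b : 'cV[R]_r)
    (f f1 f2 : 'cV[R]_m -> \bar R) (g : 'cV[R]_n -> \bar R)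
    (xs : 'cV[R]_m) (ys : 'cV[R]_n) (lams : 'cV[R]_r)
    (mu_f mu_g : R) (alpha theta gamma beta : nat -> R)
    (x v : nat -> 'cV[R]_m) (y w : nat -> 'cV[R]_n)
    (lam lamb : nat -> 'cV[R]_r),
  closed X -> convex_set X -> closed Y -> convex_set Y ->
  proper_closed_convex f -> proper_closed_convex g ->
  saddle_point X Y A B b f g xs ys lams ->
  0 <= mu_g -> 0 <= mu_f -> mu_f <= L_f ->
  (forall z, f z = (f1 z + f2 z)%E) -> S0 0 X f2 -> S11 mu_f L_f X f1 ->
  parameters mu_f mu_g alpha theta gamma beta ->
  X (x 0%N) -> X (v 0%N) ->
  let schemeH :=
    scheme_H X Y A B b f1 f2 g mu_f mu_g alpha theta gamma beta
      x v y w lam lamb in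
  let choice := multiplier_choice A B b alpha theta v w lam lamb in
  let algo :=
    algorithm X Y A B b f f1 f2 g mu_f mu_g alpha theta gamma beta
      x v y w lam lamb in
  let F := objective f g in
  let E := lyapunov X Y A B b f g theta gamma beta xs ys lams x v y w lam in
  let R0 := (sqrte (2%:E * E 0%N) + (enorm (lam 0%N - lams))%:E
             + (enorm (residual A B b (x 0%N) (y 0%N)))%:E)%E in
  [/\ (schemeH /\ choice -> algo),
      ((f (x 0%N) < +oo)%E -> algo -> schemeH /\ choice) &
      (S0 mu_g Y g ->
       (0 < mu_f -> gamma 0%N = mu_f) -> (0 < mu_g -> beta 0%N = mu_g) ->
       (forall k, (L_f * theta k + opnorm A ^+ 2) * alpha k ^+ 2
                    = gamma k * theta k) ->
       algo ->
       [/\ (forall k, (1 <= k)%N -> X (x k) /\ Y (y k)),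
           (forall k, (E k <= (theta k)%:E * E 0%N)%E) &
           (gamma 0%N <= L_f + opnorm A ^+ 2 ->
            [/\ (forall k, ((enorm (residual A B b (x k) (y k)))%:E
                              <= (theta k)%:E * R0)%E),
                (forall k, (`|F (x k) (y k) - F xs ys|
                              <= (theta k)%:E
                                 * (E 0%N + (enorm lams)%:E * R0))%E) &
                (forall k, (1 <= k)%N ->
                  ((theta k)%:E
                     <= C%:E * theta_rate (opnorm A) mu_f L_f (gamma 0%N) k)%E)
            ])])].
Proof.
(* The absolute constant of both rate estimates, chosen before all the problem data. *)
exists 36 => //.
move=> m n r X Y A B b f f1 f2 g xs ys lams mu_f mu_g alpha theta gamma beta.
move=> x v y w lam lamb _ cX _ cY ccf ccg sad mu_g0 mu_f0 mu_fL fE Sf2 Sf1 par.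
move=> Xx0 Xv0 schemeH choice algo F E R0; split.
- exact: (scheme_H_algorithm cX cY ccf ccg sad mu_g0 mu_f0 fE Sf2 Sf1 par Xx0 Xv0).
- exact: (algorithm_scheme_H cX cY ccf ccg sad mu_g0 mu_f0 fE Sf2 Sf1 par Xx0 Xv0).
move=> Sg gam0 _ step al; split.
- by move=> k k1; have [Xx _ /(_ k1)] := algorithm_in cX par Xx0 Xv0 al k.
- move=> k.
  exact: (lyapunov_decay cX cY ccf ccg sad mu_g0 mu_f0 mu_fL fE Sf2 Sf1 par
    Xx0 Xv0 Sg step al k).
move=> gaL; split=> k.
- exact: (residual_decay cX cY ccf ccg sad mu_g0 mu_f0 mu_fL fE Sf2 Sf1 par
    Xx0 Xv0 Sg step al k).
- exact: (objective_decay cX cY ccf ccg sad mu_g0 mu_f0 mu_fL fE Sf2 Sf1 par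
    Xx0 Xv0 Sg step al k).
- exact: (theta_rate_bound par mu_f0 (opnorm_ge0 A) mu_fL gam0 step gaL).
Qed.
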